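(* Let ${\rm F}$ be a $d$-type branching forest with progeny law $\nu$. \begin{itemize} \item[1.] For any ${\rm c}=(c_1,c_2,\dots)\in [d]^\infty$, under ${\bf P}_{\rm c}$, the chains $X^{(i)}=(X^{i,1},\dots,X^{i,d})$, $i=1,\dots,d$, are independent random walks with step distribution \[{\bf P}_{\rm c}\Big(X^{(i)}_1=(q_1,\dots,q_d)\Big)=\nu_i(q_1,\dots,q_{i-1},q_i+1,q_{i+1},\dots,q_d)\,.\] In particular, their laws do not depend on ${\rm c}$. For each $i\in [d]$, $X^{i,i}$ is a downward skip free random walk such that $\liminf_{n\rightarrow+\infty}X_n^{i,i}=-\infty$ a.s., and for $j\neq i$, $X^{i,j}$ is a renewal process. \item[2.] For every integer $r\ge1$, almost surely there is ${\rm r}=(r_1,\dots,r_d)\in \mathbb{Z}_+^d$ with $r=r_1+\dots+r_d$ such that there is a smallest solution ${\rm n}$ to the system $({\rm r},X)$. \item[3.] Conversely, let $Y$ be a copy of $X$ and ${\rm c}=(c_1,c_2,\dots)\in [d]^\infty$. Then to $Y$ and ${\rm c}$ we may associate a unique $d$-type branching forest, with progeny law $\nu$ and root type sequence ${\rm c}$ (i.e. the $k$-th tree has root of type $c_k$), whose coding random walk (constructed from the forest as $X$ is constructed from ${\rm F}$) is $Y$. \end{itemize}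
   Context: Let $d\ge2$, $[n]=\{1,\dots,n\}$. Let $\nu=(\nu_1,\dots,\nu_d)$ be distributions on $\mathbb{Z}_+^d$ forming the progeny law of an irreducible, non-degenerated, critical or subcritical $d$-type branching process (an individual of type $i$ has offspring vector, giving the number of children of each type, with law $\nu_i$, independently of other individuals), so that the process becomes extinct a.s. On a probability space $(\Omega,\mathcal{G},P)$, let $({\bf P}_{\rm c})_{{\rm c}\in[d]^\infty}$ be probability measures and ${\rm F}=({\rm T}_k)_{k\ge1}$ an infinite sequence of independent random plane trees such that under ${\bf P}_{\rm c}$, ${\rm T}_k$ is a branching tree with progeny law $\nu$ whose root has type $c_k$; ${\rm F}$ is called a $d$-type branching forest with progeny law $\nu$. In a plane forest, children of a common parent are ordered with nondecreasing types, and vertices are labeled in breadth first search order (trees in order, each tree read generation by generation from its root, each generation from left to right). A subtree of type $i$ is a maximal connected subgraph all of whose vertices have type $i$; the subforest ${\rm F}^{(i)}$ of type $i$ is the forest of these subtrees ranked by the order of their roots, and $({\rm u}^{(i)}_n)_{n\ge1}$ denotes its vertices in its own breadth first search order (${\rm F}^{(i)}$ is a.s. infinite). For a vertex $u$, $p_j(u)$ is its number of children of type $j$. The coding walk $X=(X^{(1)},\dots,X^{(d)})$, $X^{(i)}=(X^{i,1},\dots,X^{i,d})$, is defined by $X_0^{(i)}=0$ and, for $n\ge0$, $X_{n+1}^{i,j}-X_n^{i,j}=p_j({\rm u}_{n+1}^{(i)})$ if $i\neq j$, and $X_{n+1}^{i,i}-X_n^{i,i}=p_i({\rm u}_{n+1}^{(i)})-1$.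 For ${\rm r}\in\mathbb{Z}_+^d$, the system $({\rm r},X)$ is the set of equations $r_j+\sum_{i=1}^d X^{i,j}(s_i)=0$, $j=1,\dots,d$, in ${\rm s}=(s_1,\dots,s_d)\in\mathbb{Z}_+^d$; a solution ${\rm n}$ is the smallest solution if ${\rm n}\le{\rm s}$ componentwise for every solution ${\rm s}$ (when a solution exists, a unique smallest one exists). *)

(* Defs.v *)
From HB Require Import structures.
From mathcomp Require Import all_boot all_order all_algebra.
From mathcomp Require Import all_classical all_reals all_analysis.
From mathcomp Require Import complex.
Set Implicit Arguments. Unset Strict Implicit. Unset Printing Implicit Defensive.
Import Order.TTheory GRing.Theory Num.Theory.
Local Open Scope classical_set_scope.
Local Open Scope ring_scope.

(* Finite d-type plane trees.  A vertex carries its type in 'I_d (the *)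
(* type set [d] = {1..d} is encoded as {0..d-1}); children are listed *)
(* from left to right.                                                 *)
Section Trees.
Variable d : nat.

Inductive ttree := TNode of 'I_d & seq ttree.

Definition ttype (t : ttree) : 'I_d := let: TNode a _ := t in a.
Definition tchildren (t : ttree) : seq ttree := let: TNode _ cs := t in cs.

Definition offv (cs : seq ttree) : {ffun 'I_d -> nat} :=
  [ffun j => count (fun c => ttype c == j) cs].
Definition pvec (t : ttree) : {ffun 'I_d -> nat} := offv (tchildren t).

Fixpoint twf (t : ttree) : bool :=
  let: TNode _ cs := t in
  sorted (fun x y => (ttype x <= ttype y)%N) cs &&
  (fix allwf l := if l is c :: l' then twf c && allwf l' else true) cs.

(* number of vertices (an upper bound for the number of generations) *)
Fixpoint tsize (t : ttree) : nat :=
  let: TNode _ cs := t in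
  ((fix sz l := if l is c :: l' then (tsize c + sz l')%N else 0%N) cs).+1.

Definition nextgenp (l : seq (ttree * option 'I_d)) : seq (ttree * option 'I_d) :=
  flatten [seq [seq (c, Some (ttype v.1)) | c <- tchildren v.1] | v <- l].
Definition bfsp (t : ttree) : seq (ttree * option 'I_d) :=
  flatten [seq iter k nextgenp [:: (t, None)] | k <- iota 0 (tsize t)].

(* roots of the subtrees of type i of t, in breadth first search order:
   vertices of type i whose parent is not of type i (or which are the root) *)
Definition iroots (i : 'I_d) (t : ttree) : seq ttree :=
  [seq v.1 | v <- bfsp t & (ttype v.1 == i) && (v.2 != Some i)].

(* breadth first search of the subtree of type i rooted at v (ttype v = i):
   only children of type i are followed *)
Definition nextgeni (i : 'I_d) (l : seq ttree) : seq ttree :=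
  flatten [seq [seq c <- tchildren v | ttype c == i] | v <- l].
Definition ibfs (i : 'I_d) (v : ttree) : seq ttree :=
  flatten [seq iter k (nextgeni i) [:: v] | k <- iota 0 (tsize v)].

Definition ilist (i : 'I_d) (t : ttree) : seq {ffun 'I_d -> nat} :=
  [seq pvec u | u <- flatten [seq ibfs i v | v <- iroots i t]].

(* A plane forest is an infinite sequence of trees F : nat -> ttree
   (F k is the (k+1)-th tree).  The subforest F^(i): its vertices (their
   offspring vectors) in its own breadth first search order; the first K trees
   of F contribute the following prefix. *)
Definition iprefix (F : nat -> ttree) (i : 'I_d) (K : nat) : seq {ffun 'I_d -> nat} :=
  flatten [seq ilist i (F k) | k <- iota 0 K].

(* p(u^(i)_(n+1)) : offspring vector of the (n+1)-th vertex of F^(i)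
   (default: the zero vector if F^(i) has at most n vertices) *)
Definition ustep (F : nat -> ttree) (i : 'I_d) (n : nat) : {ffun 'I_d -> nat} :=
  match pselect (exists K, (n < size (iprefix F i K))%N) with
  | left h => nth [ffun => 0%N] (iprefix F i (ex_minn h)) n
  | right _ => [ffun => 0%N]
  end.

Definition Xw (F : nat -> ttree) (i j : 'I_d) (n : nat) : int :=
  \sum_(m < n) ((ustep F i m j)%:Z - (i == j)%:Z).

Definition Xv (F : nat -> ttree) (i : 'I_d) (n : nat) : {ffun 'I_d -> int} :=
  [ffun j => Xw F i j n].

Definition is_solution (r : 'I_d -> nat) (X : 'I_d -> 'I_d -> nat -> int)
  (s : 'I_d -> nat) : Prop :=
  forall j : 'I_d, (r j)%:Z + \sum_(i < d) X i j (s i) = 0.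
Definition is_smallest_solution (r : 'I_d -> nat) (X : 'I_d -> 'I_d -> nat -> int)
  (n : 'I_d -> nat) : Prop :=
  is_solution r X n /\ forall s, is_solution r X s -> forall i, (n i <= s i)%N.

End Trees.

Section Progeny.
Variables (R : realType) (d : nat).
Variable nu : 'I_d -> {ffun 'I_d -> nat} -> R.

Definition is_progeny_law : Prop :=
  (forall i q, 0 <= nu i q) /\
  (forall i, (\esum_(q in [set: {ffun 'I_d -> nat}]) (nu i q)%:E)%E = 1%E).

Definition mean_entry (i j : 'I_d) : \bar R :=
  (\esum_(q in [set: {ffun 'I_d -> nat}]) (nu i q * (q j)%:R)%:E)%E.

Definition finite_means : Prop := forall i j, (mean_entry i j < +oo)%E.

Definition mean_matrix : 'M[R]_d := \matrix_(i, j) fine (mean_entry i j).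

Definition irreducible_law : Prop :=
  forall i j : 'I_d, exists n : nat, 0 < (iter n (mulmx mean_matrix) mean_matrix) i j.

Definition nondegenerated_law : Prop :=
  exists i : 'I_d,
    (0 < \esum_(q in [set q : {ffun 'I_d -> nat} | (\sum_(j < d) q j)%N != 1%N])
          (nu i q)%:E)%E.

(* critical or subcritical: finite means and the Perron-Frobenius eigenvalue
   (= spectral radius of the mean matrix) is at most 1 *)
Definition crit_or_subcrit : Prop :=
  finite_means /\
  forall lambda : R[i],
    root (map_poly (real_complex R) (char_poly mean_matrix)) lambda ->
    `|lambda| <= 1.

Fixpoint tweight (t : ttree d) : R :=
  let: TNode a cs := t in
  nu a (offv cs) *
  (fix ws l := if l is c :: l' then tweight c * ws l' else 1) cs.

Definition tree_law (i : 'I_d) (t : ttree d) : R :=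
  if (ttype t == i) && twf t then tweight t else 0.

Definition step_law (i : 'I_d) (q : {ffun 'I_d -> int}) : R :=
  if [forall j, (0 <= q j + (i == j)%:Z)%R]
  then nu i [ffun j => absz (q j + (i == j)%:Z)]
  else 0.

Definition branching_forest {dO : measure_display} {O : measurableType dO}
  (P : probability O R) (F : O -> nat -> ttree d) (c : nat -> 'I_d) : Prop :=
  (forall k t, measurable [set w | F w k = t]) /\
  (forall (n : nat) (ts : nat -> ttree d),
     P [set w | forall k, (k < n)%N -> F w k = ts k] =
     (\prod_(k < n) tree_law (c k) (ts k))%:E).

Definition indep_walks_law {dO : measure_display} {O : measurableType dO}
  (P : probability O R) (Y : O -> 'I_d -> nat -> {ffun 'I_d -> int}) : Prop :=
  (forall i n z, measurable [set w | Y w i n = z]) /\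
  P [set w | forall i, Y w i 0%N = 0] = 1%E /\
  (forall (n : nat) (q : 'I_d -> nat -> {ffun 'I_d -> int}),
     P [set w | forall i m, (m < n)%N -> Y w i m.+1 - Y w i m = q i m] =
     (\prod_(i < d) \prod_(m < n) step_law i (q i m))%:E).

End Progeny.

(* Main.v *)
Require Import Defs.
From HB Require Import structures.
From mathcomp Require Import all_boot all_order all_algebra.
From mathcomp Require Import all_classical all_reals all_analysis.
From mathcomp Require Import complex.
From mathcomp Require Import zify.
Set Implicit Arguments. Unset Strict Implicit. Unset Printing Implicit Defensive.
Import Order.TTheory GRing.Theory Num.Theory.
Import numFieldNormedType.Exports.

(** The list of offspring vectors of the vertices of type i of a tree, read in
    the order of the subforest of type i, is a permutation of the offspring
    vectors of all its vertices of type i; hence the weight of a finite forest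
    is the weight of the corresponding steps of d independent walks.  Moreover
    these lists form a prefix code: two forests with the same root types whose
    codes agree, for each i, up to the shorter length are equal.  Indeed a
    monochromatic subtree, decorated with offspring vectors, is read off its
    breadth first code, and the full trees are then recovered generation by
    generation.

    Finite trees have total mass 1 because a branching forest is given, so the
    codes of forests of K trees have total mass 1 for the law of the walks.
    Almost every sample of the walks therefore starts, for each K, with the
    code of a unique forest of K trees; decoding it yields a branching forest
    coded by the walks (part 3).  A realization of the walks is given by the
    roots of a forest with periodic root types; decoding it gives a forest with
    any prescribed root types and a known coding walk, and the law of the coding
    walk is a function of the law of the forest (part 1).  Irreducibility makes
    every type occur in infinitely many trees, and completing a tree that
    contains type i lowers X^{i,i}.  Counting children shows that the numbers of
    vertices of each type in the first r trees solve the system for the root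
    types of these trees; the smallest solution is the least sub-solution
    (part 2). *)

Local Notation tsize := Defs.tsize.

(** * Vertices and codes of trees *)

Section TreeCountable.
Variable d : nat.
Local Notation T := (ttree d).

(** Countability of the type of trees lets every event about finitely many trees be split over the
    values of these trees. *)
Fixpoint ttree_encode (t : T) : GenTree.tree 'I_d :=
  let: TNode a cs := t in
  GenTree.Node 0 (GenTree.Leaf a :: map ttree_encode cs).

Fixpoint ttree_decode (g : GenTree.tree 'I_d) : option T :=
  if g is GenTree.Node _ (GenTree.Leaf a :: l)
  then Some (TNode a (pmap ttree_decode l)) else None.

Lemma ttree_rect_foldr (P : T -> Prop) :
  (forall a cs, foldr (fun c => and (P c)) True cs -> P (TNode a cs)) ->
  forall t, P t.
Proof.
move=> IH; fix rec 1 => -[a cs]; apply: IH.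
by elim: cs => [|c cs IHcs] //=; split.
Qed.

Lemma ttree_encodeK : pcancel ttree_encode ttree_decode.
Proof.
elim/ttree_rect_foldr => a cs /= H; congr (Some (TNode a _)).
by elim: cs H => [|c cs IH] //= [-> H] /=; rewrite IH.
Qed.

HB.instance Definition _ := Countable.copy T (pcan_type ttree_encodeK).

Lemma ttree_mem_ind (P : T -> Prop) :
  (forall a cs, (forall c, c \in cs -> P c) -> P (TNode a cs)) ->
  forall t, P t.
Proof.
move=> IH; elim/ttree_rect_foldr => a cs H; apply: IH.
elim: cs H => [|c cs IHcs] //= [Pc H] x; rewrite inE => /orP[/eqP->//|].
exact: IHcs.
Qed.

End TreeCountable.

Section Flatten.

Lemma flatten_map_if (A B : Type) (p : pred A) (g : A -> seq B) (s : seq A) :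
  flatten [seq if p x then g x else [::] | x <- s] =
  flatten [seq g x | x <- s & p x].
Proof. by elim: s => //= x s IH; case: ifP => _ /=; rewrite IH. Qed.

Lemma flatten_flatten (A : Type) (s : seq (seq (seq A))) :
  flatten (flatten s) = flatten (map flatten s).
Proof. by elim: s => //= x s IH; rewrite flatten_cat IH. Qed.

Lemma perm_flatten_cat (A : Type) (B : eqType) (f g : A -> seq B) (s : seq A) :
  perm_eq (flatten [seq f x ++ g x | x <- s])
          (flatten (map f s) ++ flatten (map g s)).
Proof.
elim: s => //= x s IH; rewrite -!catA perm_cat2l.
rewrite perm_sym perm_catCA perm_sym perm_cat2l; exact: IH.
Qed.

Lemma eq_perm_flatten (A B : eqType) (f g : A -> seq B) (s : seq A) :
  (forall x, x \in s -> perm_eq (f x) (g x)) ->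
  perm_eq (flatten (map f s)) (flatten (map g s)).
Proof.
elim: s => //= x s IH H; apply: perm_cat; first by apply: H; rewrite mem_head.
by apply: IH => y ys; apply: H; rewrite inE ys orbT.
Qed.

End Flatten.

(** * Traversals by generations *)

Section Levels.
Variables (A : eqType) (f : A -> seq A) (mu : A -> nat).
Hypothesis mu_gt0 : forall x, 0 < mu x.
Hypothesis mu_lt : forall x y, y \in f x -> mu y < mu x.

(** Common form of [bfsp] and [ibfs]. The rank [mu] drops from a vertex to its successors, so it
    bounds the number of nonempty generations. *)
Definition levels n (l : seq A) : seq A :=
  flatten [seq iter k (fun l => flatten (map f l)) l | k <- iota 0 n].

Lemma levelsS n l : levels n.+1 l = l ++ levels n (flatten (map f l)).
Proof.
rewrite /levels /= -[1]/(1 + 0) iotaDl -map_comp; congr (_ ++ flatten _).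
by apply: eq_map => k; rewrite [in LHS]/comp add1n iterSr.
Qed.

Lemma levels_nil n : levels n [::] = [::].
Proof. by elim: n => // n IH; rewrite levelsS /= IH. Qed.

Lemma mu_next n l : (forall x, x \in l -> mu x <= n.+1) ->
  forall x, x \in flatten (map f l) -> mu x <= n.
Proof.
move=> H x /flatten_mapP[y /H yl /mu_lt xy].
by rewrite -ltnS (leq_trans xy).
Qed.

Lemma mu_le0 l : (forall x, x \in l -> mu x <= 0) -> l = [::].
Proof.
case: l => // x l /(_ x (mem_head _ _)).
by rewrite leqNgt mu_gt0.
Qed.

Lemma iter_next_nil n l k : (forall x, x \in l -> mu x <= n) -> n <= k ->
  iter k (fun l => flatten (map f l)) l = [::].
Proof.
elim: n l k => [|n IH] l k Hl.
  by rewrite (mu_le0 Hl) => _; elim: k => //= k ->.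
by case: k => // k nk; rewrite iterSr; apply: IH => //; exact: mu_next.
Qed.

(** The equation for [desc] is that of a depth first traversal. Moving the heads of the lists
    [desc x] to the front peels off one generation and leaves the same statement for the next
    one. *)
Lemma levels_perm (desc : A -> seq A) n l :
  (forall x, desc x = x :: flatten (map desc (f x))) ->
  (forall x, x \in l -> mu x <= n) ->
  perm_eq (levels n l) (flatten (map desc l)).
Proof.
move=> descE; elim: n l => [|n IH] l Hl; first by rewrite (mu_le0 Hl).
rewrite levelsS (eq_map descE).
have := perm_flatten_cat (fun x => [:: x]) (fun x => flatten (map desc (f x))) l.
move=> /permPr ->; rewrite flatten_seq1 perm_cat2l.
rewrite (permPl (IH _ (mu_next Hl))).
by rewrite map_flatten flatten_flatten -!map_comp.
Qed.

End Levels.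

(** * Vertices, subtrees of one type and their codes *)

Section Vertices.
Variable d : nat.
Local Notation T := (ttree d).
Local Notation V := {ffun 'I_d -> nat}.

Lemma tsizeE (t : T) : tsize t = (sumn (map (@tsize d) (tchildren t))).+1.
Proof. by case: t => a cs /=; congr S; elim: cs => //= c cs ->. Qed.

Lemma tsize_gt0 (t : T) : 0 < tsize t.
Proof. by rewrite tsizeE. Qed.

Lemma tsize_child (t c : T) : c \in tchildren t -> tsize c < tsize t.
Proof.
rewrite (tsizeE t) ltnS; elim: (tchildren t) => //= x s IH.
rewrite inE => /orP[/eqP->|/IH]; first exact: leq_addr.
by move/leq_trans; apply; exact: leq_addl.
Qed.

Lemma twfE (t : T) :
  twf t = sorted (fun x y => (ttype x <= ttype y)%N) (tchildren t)
          && all (@twf d) (tchildren t).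
Proof. by case: t => a cs /=; congr andb; elim: cs => //= c cs ->. Qed.

Fixpoint verts (t : T) : seq T :=
  let: TNode a cs := t in t :: flatten (map verts cs).

Lemma vertsE t : verts t = t :: flatten (map verts (tchildren t)).
Proof. by case: t. Qed.

(** Depth first counterpart of [bfsp]; [icomp] below is that of [ibfs]. *)
Fixpoint vertsp (p : option 'I_d) (t : T) : seq (T * option 'I_d) :=
  let: TNode a cs := t in (t, p) :: flatten (map (vertsp (Some a)) cs).

Fixpoint icomp (i : 'I_d) (t : T) : seq T :=
  let: TNode a cs := t in
  t :: flatten (map (fun c => if ttype c == i then icomp i c else [::]) cs).

Lemma icompE i t : icomp i t =
  t :: flatten (map (icomp i) [seq c <- tchildren t | ttype c == i]).
Proof. by case: t => a cs /=; rewrite flatten_map_if. Qed.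

Definition kids (v : T * option 'I_d) : seq (T * option 'I_d) :=
  [seq (c, Some (ttype v.1)) | c <- tchildren v.1].

Lemma kids_tsize v w : w \in kids v -> tsize w.1 < tsize v.1.
Proof. by case/mapP => c /tsize_child ? ->. Qed.

Definition ikids (i : 'I_d) (t : T) : seq T :=
  [seq c <- tchildren t | ttype c == i].

Lemma ikids_tsize i v w : w \in ikids i v -> tsize w < tsize v.
Proof. by rewrite mem_filter => /andP[_ /tsize_child]. Qed.

Lemma bfspE t : bfsp t = levels kids (tsize t) [:: (t, None)].
Proof. by []. Qed.

Lemma ibfsE i t : ibfs i t = levels (ikids i) (tsize t) [:: t].
Proof. by []. Qed.

Lemma bfsp_perm t : perm_eq (bfsp t) (vertsp None t).
Proof.
rewrite bfspE -[vertsp None t]cats0.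
apply: (@levels_perm _ kids (fun v => tsize v.1) _ _ (fun v => vertsp v.2 v.1)).
- by move=> x; exact: tsize_gt0.
- exact: kids_tsize.
- by case=> -[a cs] p /=; rewrite -map_comp.
- by move=> x; rewrite inE => /eqP->.
Qed.

Lemma ibfs_perm i t : perm_eq (ibfs i t) (icomp i t).
Proof.
rewrite ibfsE -[icomp i t]cats0.
apply: (@levels_perm _ _ (@tsize d) _ _ (icomp i)).
- exact: tsize_gt0.
- exact: ikids_tsize.
- exact: icompE.
- by move=> x; rewrite inE => /eqP->.
Qed.

Definition isroot (i : 'I_d) (v : T * option 'I_d) : bool :=
  (ttype v.1 == i) && (v.2 != Some i).

Lemma filter_verts_cons i a (cs : seq T) :
  [seq u <- verts (TNode a cs) | ttype u == i] =
  (if a == i then [:: TNode a cs] else [::]) ++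
  flatten [seq [seq u <- verts c | ttype u == i] | c <- cs].
Proof. by rewrite /= filter_flatten -map_comp; case: ifP. Qed.

(** Each vertex of type [i] lies in the component of exactly one subtree root. When [t] and its
    parent both have type [i], [t] is not such a root and its component is added separately. *)
Lemma icomp_perm i t p :
  perm_eq (flatten [seq icomp i v.1 | v <- vertsp p t & isroot i v] ++
             (if (ttype t == i) && (p == Some i) then icomp i t else [::]))
          [seq u <- verts t | ttype u == i].
Proof.
elim/ttree_mem_ind: t p => a cs IH p.
rewrite filter_verts_cons.
set R := fun p t => flatten [seq icomp i v.1 | v <- vertsp p t & isroot i v].
have RE : R p (TNode a cs) =
    (if (a == i) && (p != Some i) then icomp i (TNode a cs) else [::])
    ++ flatten [seq R (Some a) c | c <- cs].
  rewrite /R /= filter_flatten -map_comp.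
  have -> : isroot i (TNode a cs, p) = (a == i) && (p != Some i) by [].
  by case: ifP => _ /=; rewrite map_flatten flatten_flatten -!map_comp.
rewrite -/(R p (TNode a cs)) RE /=.
have [ai|ai] /= := eqVneq a i; last first.
  rewrite cats0 /=; apply: eq_perm_flatten => c cc.
  have := IH c cc (Some a); rewrite -/(R _ _).
  have -> : (Some a == Some i) = false by apply/eqP => -[] /eqP; apply/negP.
  by rewrite andbF cats0.
(* If the root has type [i], its children of type [i] are not subtree roots; their components make
   up the rest of the component of the root. *)
have step : perm_eq (flatten [seq R (Some a) c | c <- cs] ++
     flatten [seq (if ttype c == i then icomp i c else [::]) | c <- cs])
   (flatten [seq [seq u <- verts c | ttype u == i] | c <- cs]).
  rewrite -(permPl (perm_flatten_cat _ _ _)); apply: eq_perm_flatten => c cc.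
  have := IH c cc (Some a); rewrite -/(R _ _).
  by rewrite ai eqxx andbT.
rewrite perm_sym in step.
case: (p == Some i) => /=.
  rewrite -cat1s perm_catCA perm_cat2l.
  by rewrite perm_sym (permPl step).
rewrite cats0 /= perm_cons perm_sym (permPl step).
by rewrite perm_catC.
Qed.

Lemma ilist_perm i t :
  perm_eq (ilist i t) [seq pvec u | u <- verts t & ttype u == i].
Proof.
rewrite /ilist; apply: perm_map.
have := icomp_perm i t None; rewrite andbF cats0 => /permPr <-.
rewrite (permPl (eq_perm_flatten (g := icomp i) _)); last by move=> *; exact: ibfs_perm.
rewrite /iroots -map_comp; apply: perm_flatten; apply: perm_map.
by apply: perm_filter; exact: bfsp_perm.
Qed.

(** Every vertex other than [t] is a child of exactly one vertex. *)
Lemma big_pvec_type (t : T) (j : 'I_d) :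
  (ttype t == j) + \sum_(u <- verts t) pvec u j = count (fun u => ttype u == j) (verts t).
Proof.
elim/ttree_mem_ind: t => a cs IH.
rewrite vertsE /= big_cons; congr addn.
rewrite big_flatten big_map count_flatten sumnE -map_comp big_map.
rewrite /pvec /= ffunE -sum1_count big_mkcond -big_split /=.
rewrite big_seq [RHS]big_seq; apply: eq_bigr => c cc.
by rewrite -IH //; case: (ttype c == j).
Qed.

(** A component is a tree: it has one vertex more than it has edges. *)
Lemma icomp_sum (i : 'I_d) (t : T) :
  \sum_(u <- icomp i t) pvec u i + 1 = size (icomp i t).
Proof.
elim/ttree_mem_ind: t => a cs IH.
rewrite icompE /= big_cons /pvec /= ffunE addn1; congr S.
rewrite big_flatten big_map size_flatten /shape sumnE !big_map -size_filter -sum1_size.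
rewrite -big_split /= big_seq [RHS]big_seq; apply: eq_bigr => c.
by rewrite mem_filter => /andP[_ /IH <-]; rewrite addnC.
Qed.

Lemma ilist_sum (i : 'I_d) (t : T) :
  \sum_(v <- ilist i t) v i + size (iroots i t) = size (ilist i t).
Proof.
rewrite /ilist big_map size_map size_flatten /shape sumnE 2!big_map big_flatten big_map.
rewrite -sum1_size -big_split /=. apply: eq_bigr => u _.
by rewrite (perm_big _ (ibfs_perm i u)) (perm_size (ibfs_perm i u)) icomp_sum.
Qed.

Lemma iroots_neq0 (i : 'I_d) (t : T) :
  has (fun u => ttype u == i) (verts t) -> 0 < size (iroots i t).
Proof.
rewrite has_count -size_filter -(size_map (@pvec d)) -(perm_size (ilist_perm i t)).
by rewrite /ilist size_map; case: (iroots i t).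
Qed.

End Vertices.

(** * Unique decodability *)

Section Compatible.
Variable A : Type.

(** Amounts to one list being a prefix of the other, in a symmetric form. *)
Definition compatible (l l' : seq A) : Prop := exists r r', l ++ r = l' ++ r'.

Lemma compatible_cat2l (x l l' : seq A) : compatible (x ++ l) (x ++ l') -> compatible l l'.
Proof.
move=> [r [r']]; rewrite -!catA => H; exists r, r'.
by elim: x H => //= y x IH [] /IH.
Qed.

Lemma compatible_catl (x x' l l' : seq A) :
  compatible (x ++ l) (x' ++ l') -> compatible x x'.
Proof. by case=> r [r']; rewrite -!catA => H; exists (l ++ r), (l' ++ r'). Qed.

Lemma nth_compatible (x0 : A) (l l' : seq A) :
  (forall m, m < size l -> m < size l' -> nth x0 l m = nth x0 l' m) ->
  compatible l l'.
Proof.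
elim: l l' => [|x l IH] [|x' l'] H.
- by exists [::], [::].
- by exists (x' :: l'), [::]; rewrite cats0.
- by exists [::], (x :: l); rewrite cats0.
have [|r [r' rr']] := IH l'; first by move=> m ml ml'; exact: (H m.+1).
by exists r, r'; rewrite /= rr' (H 0 isT isT : x = x').
Qed.

End Compatible.

(** * Recovering a tree from its codes *)

Section Decorated.
Variable d : nat.
Local Notation T := (ttree d).
Local Notation V := {ffun 'I_d -> nat}.

Inductive dtree := DNode of V & seq dtree.

(* The monochromatic subtree hanging at a vertex, every vertex being
   decorated with its full offspring vector. *)
Fixpoint dec (t : T) : dtree :=
  let: TNode a cs := t in
  DNode (offv cs)
    (flatten (map (fun c => if ttype c == a then [:: dec c] else [::]) cs)).

Lemma decE t : dec t = DNode (pvec t) (map dec (ikids (ttype t) t)).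
Proof.
case: t => a cs /=; congr DNode.
by rewrite flatten_map_if -[RHS]flatten_seq1 -map_comp.
Qed.

Lemma size_ikids i (t : T) : size (ikids i t) = pvec t i.
Proof. by rewrite size_filter /pvec ffunE. Qed.

Lemma eq_map_shape (A B : Type) (f : A -> seq B) (l l' : seq A) :
  map (size \o f) l = map (size \o f) l' ->
  flatten (map f l) = flatten (map f l') -> map f l = map f l'.
Proof.
by move=> Hs Hf; apply: eq_from_flatten_shape => //; rewrite /shape -!map_comp.
Qed.

(** The offspring vectors of a generation give the number of children of type [i] of each vertex,
    hence the size of the next generation and its division into siblings. The tails [r] and [r']
    hold the codes of what follows. *)
Lemma levels_dec i n n' (l l' : seq T) r r' :
  (forall x, x \in l -> ttype x = i /\ tsize x <= n) ->
  (forall x, x \in l' -> ttype x = i /\ tsize x <= n') ->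
  size l = size l' ->
  map (@pvec d) (levels (ikids i) n l) ++ r =
  map (@pvec d) (levels (ikids i) n' l') ++ r' ->
  map dec l = map dec l' /\ r = r'.
Proof.
elim: n n' l l' r r' => [|n IH] n' l l' r r' Hl Hl' ss.
  have l0 : l = [::] by apply: (mu_le0 (@tsize_gt0 d)) => x /Hl[].
  move: ss; rewrite {}l0 => /esym/size0nil ->.
  by rewrite !levels_nil.
case: n' Hl' => [|n'] Hl'.
  have l0 : l' = [::] by apply: (mu_le0 (@tsize_gt0 d)) => x /Hl'[].
  move: ss; rewrite {}l0 => /size0nil ->.
  by rewrite !levels_nil.
rewrite !levelsS !map_cat -!catA => /eqP.
rewrite eqseq_cat ?size_map // => /andP[/eqP pl /eqP].
have Hnext m (s : seq T) : (forall x, x \in s -> ttype x = i /\ tsize x <= m.+1) ->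
    forall x, x \in flatten (map (ikids i) s) -> ttype x = i /\ tsize x <= m.
  move=> Hs x xs; split.
    by case/flatten_mapP: xs => y _; rewrite mem_filter => /andP[/eqP].
  by apply: (mu_next (@ikids_tsize d i) _ xs) => y /Hs[].
have sk (s : seq T) : map (size \o ikids i) s = map (fun v : V => v i) (map (@pvec d) s).
  by rewrite -map_comp; apply: eq_map => x; rewrite /= size_ikids.
case/IH; [exact: Hnext|exact: Hnext| |].
  rewrite !size_flatten /shape -!map_comp /=.
  by have := sk l; rewrite pl -sk => ->.
rewrite !map_flatten -!map_comp => Hf ->; split=> //.
(* The decorations of the next generation agree as one list; the offspring vectors just read cut it
   into the same groups. *)
have Hm : map (map dec \o ikids i) l = map (map dec \o ikids i) l'.
  apply: eq_map_shape Hf.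
  have E (s : seq T) : map (size \o (map dec \o ikids i)) s = map (size \o ikids i) s.
    by apply: eq_map => x; rewrite /= size_map.
  by rewrite !E !sk pl.
clear -Hl Hl' pl Hm.
elim: l l' Hl Hl' pl Hm => [|x l IH] [|x' l'] //= Hl Hl' [px pl] [Hx Hm].
rewrite !decE px (proj1 (Hl x (mem_head _ _))) (proj1 (Hl' x' (mem_head _ _))) Hx.
congr cons; apply: IH => // y yl; [apply: Hl|apply: Hl'];
  by rewrite inE yl orbT.
Qed.

Lemma ibfs_dec i (l l' : seq T) :
  (forall x, x \in l -> ttype x = i) -> (forall x, x \in l' -> ttype x = i) ->
  compatible (map (@pvec d) (flatten (map (ibfs i) l)))
             (map (@pvec d) (flatten (map (ibfs i) l'))) ->
  compatible (map dec l) (map dec l').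
Proof.
elim: l l' => [|x l IH] [|x' l'] Hl Hl' C.
- by exists [::], [::].
- by exists (map dec (x' :: l')), [::]; rewrite cats0.
- by exists [::], (map dec (x :: l)); rewrite cats0.
case: C => r [r']; rewrite /= !map_cat -!catA !ibfsE => /(@levels_dec i).
case=> //.
- by move=> y; rewrite inE => /eqP->; split=> //; rewrite Hl ?mem_head.
- by move=> y; rewrite inE => /eqP->; split=> //; rewrite Hl' ?mem_head.
move=> [xx'] E; case: (IH l') => [y yl|y yl||s [s' ss]].
- by apply: Hl; rewrite inE yl orbT.
- by apply: Hl'; rewrite inE yl orbT.
- by exists r, r'.
by exists s, s'; rewrite /= xx' ss.
Qed.

(** [key] is what is known of a vertex once its generation is decoded, [skel] what the previous
    generation already tells: the decoration is missing exactly when the vertex starts a new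
    subtree. [rts] collects these vertices. *)
Definition key (v : T * option 'I_d) := (ttype v.1, v.2, dec v.1).
Definition skel (v : T * option 'I_d) :=
  (ttype v.1, v.2, if v.2 == Some (ttype v.1) then Some (dec v.1) else None).
Definition rts i (l : seq (T * option 'I_d)) := [seq v.1 | v <- l & isroot i v].

Lemma rts_cat i l l' : rts i (l ++ l') = rts i l ++ rts i l'.
Proof. by rewrite /rts filter_cat map_cat. Qed.

Lemma rts_key i l l' : map key l = map key l' -> map dec (rts i l) = map dec (rts i l').
Proof.
elim: l l' => [|v l IH] [|v' l'] //= [tt' pp' dd'] /IH E.
by rewrite /rts /= /isroot tt' pp'; case: ifP => _ //=; rewrite dd' E.
Qed.

(** The first vertex with a missing decoration heads the list of roots of its type on both sides, so
    compatibility forces equal decorations. *)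
Lemma fill_skel l l' : map skel l = map skel l' ->
  (forall i, compatible (map dec (rts i l)) (map dec (rts i l'))) ->
  map key l = map key l'.
Proof.
elim: l l' => [|v l IH] [|v' l'] //= [tt' pp' dd'] E C.
have dv : dec v.1 = dec v'.1.
  move: dd'; rewrite -pp' -tt'; case: ifP => [_ []//|/negbT nr _].
  have := C (ttype v.1); rewrite /rts /= /isroot -tt' -pp' eqxx nr /=.
  by case=> r [r' []].
congr cons; first by rewrite /key tt' pp' dv.
apply: IH => // i; move: (C i); rewrite /rts /= /isroot -tt' -pp'.
by case: ifP => //= _ [r [r' [_ H]]]; exists r, r'.
Qed.

(** A nondecreasing sequence of types is determined by the number of occurrences of each type. *)
Lemma eq_offv_types (cs cs' : seq T) :
  sorted (fun x y => ttype x <= ttype y) cs -> sorted (fun x y => ttype x <= ttype y) cs' ->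
  offv cs = offv cs' -> map (@ttype d) cs = map (@ttype d) cs'.
Proof.
move=> S S' E.
apply: (@sorted_eq _ (fun x y : 'I_d => x <= y)).
- by move=> x y z; exact: leq_trans.
- by move=> x y H; apply: val_inj; apply/eqP; rewrite eqn_leq.
- by rewrite sorted_map.
- by rewrite sorted_map.
apply/allP => j _ /=; move/ffunP/(_ j): E; rewrite !ffunE !count_map => E.
by apply/eqP; exact: E.
Qed.

(** The decoration of a parent contains those of its children of the same type; [skel] asks for no
    other. *)
Lemma skel_kids v v' : twf v.1 -> twf v'.1 -> key v = key v' ->
  map skel (kids v) = map skel (kids v').
Proof.
case: v v' => [t p] [t' p'] /=; rewrite !twfE => /andP[S _] /andP[S' _] [tt' _].
rewrite !decE => -[pp' dd'].
have Et := eq_offv_types S S' pp'.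
rewrite /kids /= -!map_comp -tt' in dd' *.
rewrite /ikids in dd'.
elim: (tchildren t) (tchildren t') Et dd' => [|c cs IH] [|c' cs'] //= [tc Et].
have Ec : (Some (ttype t) == Some (ttype c)) = (ttype c == ttype t).
  by apply/eqP/eqP => [[]|->].
rewrite -tc; case: ifP => cc /=; [case=> dc /(IH _ Et) -> | move/(IH _ Et) ->];
  by congr (_ :: _); rewrite /skel /= -tc Ec cc ?dc.
Qed.

Definition gen h (t : T) := iter h (@nextgenp d) [:: (t, None)].

Lemma skel_next l l' : all (@twf d) (map fst l) -> all (@twf d) (map fst l') ->
  map key l = map key l' -> map skel (nextgenp l) = map skel (nextgenp l').
Proof.
elim: l l' => [|v l IH] [|v' l'] // /andP[wv wl] /andP[wv' wl'] [E1 E2 E3 E].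
rewrite /nextgenp /= !map_cat -!/(nextgenp _) (IH l') //; congr cat.
by apply: skel_kids => //; rewrite /key E1 E2 E3.
Qed.

Lemma twf_next l : all (@twf d) (map fst l) -> all (@twf d) (map fst (nextgenp l)).
Proof.
move=> /allP H; apply/allP => x /mapP[w /flatten_mapP[v vl /mapP[c cv ->]] -> /=].
have := H v.1 (map_f _ vl); rewrite twfE => /andP[_ /allP]; exact.
Qed.

Lemma twf_gen h t : twf t -> all (@twf d) (map fst (gen h t)).
Proof. by move=> wt; elim: h => [|h IH] /=; rewrite ?wt // twf_next. Qed.

(** Equality climbs from the last generation upwards: equal next generations are cut into sibling
    lists by the offspring vectors stored in the keys. *)
Lemma key_nextgenp_inj n (l l' : seq (T * option 'I_d)) :
  (forall v, v \in l -> tsize v.1 <= n) ->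
  (forall h, map key (iter h (@nextgenp d) l) = map key (iter h (@nextgenp d) l')) ->
  l = l'.
Proof.
have sz0 (v : T * option 'I_d) : 0 < tsize v.1 by exact: tsize_gt0.
elim: n l l' => [|n IH] l l' Hl K.
  have l0 : l = [::] by exact: (mu_le0 sz0).
  by move: (K 0); rewrite {}l0 /=; case: l' {K}.
have Enext : nextgenp l = nextgenp l'.
  apply: IH => [v|h]; last by rewrite -!iterSr; exact: K.
  exact: (mu_next (@kids_tsize d)).
have K0 : map key l = map key l' := K 0.
have Ek : map (@kids d) l = map (@kids d) l'.
  apply: eq_map_shape; last exact: Enext.
  clear -K0; elim: l l' K0 => [|v l IH] [|v' l'] //= [tt' _ dd'] /IH ->.
  congr cons; rewrite !size_map.
  move: dd'; rewrite !decE => -[pp' _].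
  have sE (t : T) : size (tchildren t) = \sum_j pvec t j.
    rewrite /pvec; under eq_bigr do rewrite ffunE.
    elim: (tchildren t) => [|c cs IHc] /=; first by rewrite big1.
    rewrite big_split -IHc /= (bigD1 (ttype c)) //= eqxx big1 // => j /negbTE.
    by rewrite eq_sym => ->.
  by rewrite !sE pp'.
clear -K0 Ek.
elim: l l' K0 Ek => [|[[a cs] p] l IH] [|[[a' cs'] p'] l'] //= [-> -> _ _] /IH E [Hk /E ->].
congr (_ :: _); congr (_, _); congr TNode.
have := congr1 (map fst) Hk; rewrite /kids /= -!map_comp /=.
by rewrite !map_id.
Qed.

(** For [h] beyond the size of [t] the extra generations are empty, so a reading stopped at any [h]
    sees an initial piece of the roots. *)
Lemma iroots_prefix i h (t : T) :
  exists x, rts i (flatten [seq gen k t | k <- iota 0 h]) ++ x = iroots i t.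
Proof.
have -> : iroots i t = rts i (flatten [seq gen k t | k <- iota 0 (tsize t)]) by [].
have [le|/ltnW le] := leqP h (tsize t).
  exists (rts i (flatten [seq gen k t | k <- iota h (tsize t - h)])).
  by rewrite -rts_cat -flatten_cat -map_cat -[X in iota X (_ - _)]add0n -iotaD subnKC.
exists [::]; rewrite cats0 -(subnKC le) iotaD map_cat flatten_cat add0n.
suff H : forall m s, tsize t <= s -> flatten [seq gen k t | k <- iota s m] = [::].
  by rewrite (H (h - tsize t)) ?cats0.
elim=> [|m IH] s ts //=; rewrite IH ?cats0; last exact: leqW.
apply: (@iter_next_nil _ (@kids d) (fun v => tsize v.1) _ _ (tsize t)) => //.
- by move=> x; exact: tsize_gt0.
- exact: kids_tsize.
- by move=> x; rewrite inE => /eqP ->.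
Qed.

Lemma rts_type i l x : x \in rts i l -> ttype x = i.
Proof. by case/mapP => v; rewrite mem_filter => /andP[/andP[/eqP ? _] _] ->. Qed.

(* Generation by generation: the types and the decorations of a generation
   determine the types of the next one and the decorations of its non-root
   vertices, while the decorations of the new roots of type i are the next
   ones read from the code of type i. *)
Lemma ilist_inj (t t' : T) : twf t -> twf t' -> ttype t = ttype t' ->
  (forall i, compatible (ilist i t) (ilist i t')) -> t = t'.
Proof.
move=> wt wt' tt' C.
have CR i h : compatible (map dec (rts i (flatten [seq gen k t | k <- iota 0 h])))
                         (map dec (rts i (flatten [seq gen k t' | k <- iota 0 h]))).
  have [x Ex] := iroots_prefix i h t; have [x' Ex'] := iroots_prefix i h t'.
  apply: (@compatible_catl _ _ _ (map dec x) (map dec x')).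
  rewrite -!map_cat Ex Ex'; apply: (@ibfs_dec i); [exact: rts_type|exact: rts_type|].
  exact: C.
have K h : map key (gen h t) = map key (gen h t').
  have [n hn] := ubnP h; elim: n => // n IHn in h hn *.
  have IH k : k < h -> map key (gen k t) = map key (gen k t').
    by move=> kh; apply: IHn; apply: leq_trans kh _; rewrite -ltnS.
  apply: fill_skel.
    case: h IH {hn} => [|h] IH; first by rewrite /= /skel /= tt'.
    by apply: skel_next; [exact: twf_gen|exact: twf_gen|exact: IH].
  (* The roots of the generations before [h] agree by induction and cancel, leaving compatible lists
     for generation [h]. *)
  move=> i; have := CR i h.+1.
  rewrite -addn1 iotaD !map_cat !flatten_cat !rts_cat !map_cat /= !cats0 add0n.
  rewrite (@rts_key i (flatten [seq gen k t | k <- iota 0 h])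
                      (flatten [seq gen k t' | k <- iota 0 h])); first exact: compatible_cat2l.
  rewrite !map_flatten -!map_comp; congr flatten.
  by apply/eq_in_map => k; rewrite mem_iota => /andP[_ /IH].
suff [] : [:: (t, None)] = [:: (t', @None 'I_d)] by [].
by apply: (@key_nextgenp_inj (tsize t)) => // v; rewrite inE => /eqP->.
Qed.

Definition ocode (i : 'I_d) (s : seq T) : seq V := flatten (map (ilist i) s).

Lemma ocode_cons i t s : ocode i (t :: s) = ilist i t ++ ocode i s.
Proof. by []. Qed.

Lemma ocode_rcons i t s : ocode i (rcons s t) = ocode i s ++ ilist i t.
Proof. by rewrite /ocode map_rcons flatten_rcons. Qed.

Lemma ocode_cat i s s' : ocode i (s ++ s') = ocode i s ++ ocode i s'.
Proof. by rewrite /ocode map_cat flatten_cat. Qed.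

(** Prefix code property: the first trees agree, their codes cancel, and the remaining codes are
    again compatible. *)
Lemma ocode_inj (s s' : seq T) : all (@twf d) s -> all (@twf d) s' ->
  map (@ttype d) s = map (@ttype d) s' ->
  (forall i, compatible (ocode i s) (ocode i s')) -> s = s'.
Proof.
elim: s s' => [|t s IH] [|t' s'] //= /andP[wt ws] /andP[wt' ws'] [tt' ss'] C.
have E : t = t'.
  by apply: ilist_inj => // i; exact: compatible_catl (C i).
rewrite -E (IH s') // => i; have := C i; rewrite -E; exact: compatible_cat2l.
Qed.

Lemma ilist_offspring_sum j (t : T) :
  (ttype t == j) + \sum_i \sum_(v <- ilist i t) v j = size (ilist j t).
Proof.
rewrite (perm_size (ilist_perm j t)) size_map size_filter -big_pvec_type; congr addn.
under eq_bigr do rewrite (perm_big _ (ilist_perm _ _)) big_map big_filter.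
rewrite (exchange_big_dep xpredT) //=; apply: eq_bigr => u _.
by rewrite (big_pred1 (ttype u)) // => i; rewrite eq_sym.
Qed.

End Decorated.

Local Open Scope classical_set_scope.
Local Open Scope ring_scope.

(** * The coding walk *)

Section SmallestSolution.
Variables (d : nat) (r : 'I_d -> nat) (X : 'I_d -> 'I_d -> nat -> int).
Hypothesis X0 : forall i j, X i j 0%N = 0.
Hypothesis X_skip : forall i n, -1 <= X i i n.+1 - X i i n.
Hypothesis X_mono : forall i j n, j != i -> X i j n <= X i j n.+1.

Let f (s : 'I_d -> nat) (j : 'I_d) : int := (r j)%:Z + \sum_(i < d) X i j (s i).
Let subsol s := forall j, f s j <= 0.

Let X_le i j m n : j != i -> (m <= n)%N -> X i j m <= X i j n.
Proof.
move=> ij; elim: n => [|n IH]; first by rewrite leqn0 => /eqP->.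
rewrite leq_eqVlt => /orP[/eqP->//|]; rewrite ltnS => /IH H.
exact: le_trans H (X_mono _ ij).
Qed.

Let f_le s s' j : s j = s' j -> (forall i, (s i <= s' i)%N) -> f s j <= f s' j.
Proof.
move=> ss' le; rewrite lerD2l; apply: ler_sum => i _.
by have [<-|ij] := eqVneq j i; [rewrite ss' | exact: X_le].
Qed.

(** In coordinate [j] the minimum is one of the two, say [s j]; lowering the other coordinates can
    only lower the off-diagonal terms of equation [j]. *)
Let subsol_min s s' : subsol s -> subsol s' -> subsol (fun i => minn (s i) (s' i)).
Proof.
move=> Hs Hs' j; have [le|/ltnW le] := leqP (s j) (s' j).
  apply: le_trans (Hs j); apply: f_le => [|i]; last exact: geq_minl.
  exact/minn_idPl.
apply: le_trans (Hs' j); apply: f_le => [|i]; last exact: geq_minr.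
exact/minn_idPr.
Qed.

Let skip_free_hits (g : nat -> int) (c : int) n :
  (forall m, -1 <= g m.+1 - g m) -> c <= g 0%N -> g n < c ->
  exists2 m, (m < n)%N & g m = c.
Proof.
move=> gs g0; elim: n => [|n IH] gn; first by move: gn; rewrite ltNge g0.
have [/IH[m mn gm]|gnc] := ltP (g n) c; first by exists m => //; exact: ltnW.
exists n => //; have := gs n; lia.
Qed.

(** If [f s j] is negative, move [s j] back to an earlier time where equation [j] holds, which
    exists by skip freeness. The other left sides can only decrease, so a sub-solution of smaller
    total appears. *)
Let subsol_solution s : subsol s ->
  (forall s', subsol s' -> (\sum_i s i <= \sum_i s' i)%N) -> is_solution r X s.
Proof.
move=> Hs smin j; rewrite -/(f s j).
apply/eqP; rewrite eq_le Hs leNgt; apply/negP => fj.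
pose s_ m : 'I_d -> nat := fun i => if i == j then m else s i.
have fE m : f (s_ m) j = X j j m + (f s j - X j j (s j)).
  rewrite /f (bigD1 j) //= [in RHS](bigD1 j) //= {1}/s_ eqxx.
  rewrite (eq_bigr (fun i => X i j (s i))); first by lia.
  by move=> i /negbTE ij; rewrite /s_ ij.
have [m ms gm] : exists2 m, (m < s j)%N & X j j m = X j j (s j) - f s j.
  apply: skip_free_hits => //; last by lia.
  (* At time 0 of walk [j] only [r j] and nondecreasing walks started at 0 remain. *)
  rewrite X0; suff : 0 <= f (s_ 0%N) j by rewrite fE X0; lia.
  rewrite addr_ge0 //; apply: sumr_ge0 => i _; rewrite /s_.
  case: eqVneq => [->|ij]; first by rewrite X0.
  by rewrite -(X0 i j) X_le // eq_sym.
have sub : subsol (s_ m).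
  move=> k; have [->|kj] := eqVneq k j; first by rewrite fE gm; lia.
  apply: le_trans (Hs k); apply: f_le; first by rewrite /s_ (negbTE kj).
  by move=> i; rewrite /s_; case: eqVneq => [->|//]; exact: ltnW.
have := smin _ sub; apply/negP; rewrite -ltnNge.
rewrite (bigD1 j) //= [X in (_ < X)%N](bigD1 j) //= /s_ eqxx.
rewrite (eq_bigr s) ?ltn_add2r // => i /negbTE -> //.
Qed.

(** A sub-solution of least total is a solution. Its minimum with any other solution is a
    sub-solution, whose total would be smaller if a coordinate were. *)
Lemma smallest_solution_exists s :
  is_solution r X s -> exists n, is_smallest_solution r X n.
Proof.
move=> Hs; have subs t : is_solution r X t -> subsol t by move=> H j; rewrite /f H.
have ex : exists m, `[< exists2 t, subsol t & \sum_i t i = m >]%N.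
  by exists (\sum_i s i)%N; apply/asboolP; exists s => //; exact: subs.
case: (ex_minnP ex) => m /asboolP[n Hn nm] mmin.
have nmin t : subsol t -> (\sum_i n i <= \sum_i t i)%N.
  by move=> Ht; rewrite nm; apply: mmin; apply/asboolP; exists t.
exists n; split=> [|t /subs Ht i]; first exact: subsol_solution.
have := nmin _ (subsol_min Hn Ht); rewrite leqNgt => /negP le.
rewrite leqNgt; apply/negP => ti; apply: le.
rewrite (bigD1 i) //= [X in (_ < X)%N](bigD1 i) //=.
rewrite -addSn leq_add ?leq_sum // ?gtn_min ?ti ?orbT // => k _; exact: geq_minl.
Qed.

End SmallestSolution.

(** * The coding walk at the end of the first trees *)

Section Coding.
Variable d : nat.
Local Notation T := (ttree d).
Local Notation V := {ffun 'I_d -> nat}.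

Definition trees (F : nat -> T) K : seq T := [seq F k | k <- iota 0 K].

Lemma size_trees (F : nat -> T) K : size (trees F K) = K.
Proof. by rewrite size_map size_iota. Qed.

Lemma nth_trees t0 F K k : (k < K)%N -> nth t0 (trees F K) k = F k.
Proof. by move=> kK; rewrite (nth_map 0%N) ?size_iota // nth_iota. Qed.

Lemma treesS (F : nat -> T) K : trees F K.+1 = rcons (trees F K) (F K).
Proof. by rewrite /trees -addn1 iotaD map_cat cats1. Qed.

Lemma iprefixE (F : nat -> T) i K : iprefix F i K = ocode i (trees F K).
Proof. by rewrite /ocode /trees -map_comp. Qed.

Lemma iprefix_mono (F : nat -> T) i K K' : (K <= K')%N ->
  exists l, iprefix F i K' = iprefix F i K ++ l.
Proof.
move=> le; rewrite !iprefixE /trees -(subnKC le) iotaD map_cat ocode_cat.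
by eexists.
Qed.

Lemma ustepE (F : nat -> T) i n K : (n < size (iprefix F i K))%N ->
  ustep F i n = nth [ffun => 0%N] (iprefix F i K) n.
Proof.
move=> nK; rewrite /ustep; case: pselect => [h|[]]; last by exists K.
case: ex_minnP => m nm mmin.
by have [l ->] := iprefix_mono F i (mmin _ nK); rewrite nth_cat nm.
Qed.

Definition stepv (i : 'I_d) (v : V) : {ffun 'I_d -> int} :=
  [ffun j => (v j)%:Z - (i == j)%:Z].

Lemma stepv_inj i : injective (stepv i).
Proof.
move=> v v' /ffunP H; apply/ffunP => j; have := H j; rewrite !ffunE.
by move/addIr => -[].
Qed.

Lemma Xv0 F i : Xv F i 0 = 0 :> {ffun 'I_d -> int}.
Proof. by apply/ffunP => j; rewrite !ffunE /Xw big_ord0. Qed.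

Lemma XwS (F : nat -> T) i j n : Xw F i j n.+1 = Xw F i j n + stepv i (ustep F i n) j.
Proof. by rewrite /Xw big_ord_recr /= ffunE. Qed.

Lemma XvS (F : nat -> T) i n : Xv F i n.+1 - Xv F i n = stepv i (ustep F i n).
Proof. by apply/ffunP => j; rewrite !ffunE XwS ffunE addrAC subrr add0r. Qed.

Lemma Xw_skip (F : nat -> T) i n : -1 <= Xw F i i n.+1 - Xw F i i n.
Proof. rewrite XwS ffunE eqxx; lia. Qed.

Lemma Xw_mono (F : nat -> T) i j n : j != i -> Xw F i j n <= Xw F i j n.+1.
Proof. by rewrite XwS ffunE eq_sym => /negbTE ->; rewrite lerDl subr0. Qed.

Lemma Xw_iprefix (F : nat -> T) i j K :
  Xw F i j (size (iprefix F i K)) =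
  (\sum_(v <- iprefix F i K) v j)%N%:Z - (size (iprefix F i K) * (i == j))%N%:Z.
Proof.
rewrite /Xw (eq_bigr (fun m : 'I__ =>
   (nth [ffun=> 0%N] (iprefix F i K) m j)%:Z - (i == j)%:Z)); last first.
  by move=> m _; rewrite (@ustepE _ _ _ K).
rewrite sumrB sumr_const card_ord; congr (_ - _).
  by rewrite (big_nth [ffun=> 0%N]) big_mkord raddf_sum.
by rewrite -mulr_natl PoszM natz.
Qed.

Lemma ocode_offspring_sum j (s : seq T) :
  (count (fun t => ttype t == j) s + \sum_i \sum_(v <- ocode i s) v j)%N = size (ocode j s).
Proof.
elim: s => [|t s IH] /=.
  by rewrite big1 // => i _; rewrite /ocode big_nil.
under eq_bigr do rewrite ocode_cons big_cat /=.
rewrite ocode_cons size_cat -IH big_split /= -ilist_offspring_sum.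
exact: addnACA.
Qed.

(** A vertex of type [j] is either a root or a child of exactly one vertex; this count is equation
    [j]. *)
Lemma forest_solution (F : nat -> T) K :
  is_solution (fun j => count (fun t => ttype t == j) (trees F K)) (Xw F)
    (fun i => size (iprefix F i K)).
Proof.
move=> j; under eq_bigr do rewrite Xw_iprefix.
rewrite sumrB [X in _ + (_ - X)](bigD1 j) //= eqxx muln1 [X in _ - (_ + X)]big1 ?addr0; last first.
  by move=> i /negbTE ->; rewrite muln0.
rewrite [in X in _ - X]iprefixE -ocode_offspring_sum.
under [in X in _ - X]eq_bigr do rewrite -iprefixE.
by rewrite PoszD raddf_sum addrA subrr.
Qed.

(** Each completed subtree of type [i] has one vertex more than edges, hence contributes -1 in
    total. *)
Lemma Xw_diag_iprefix (F : nat -> T) i K :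
  Xw F i i (size (iprefix F i K)) = - (\sum_(k < K) size (iroots i (F k)))%N%:Z.
Proof.
rewrite Xw_iprefix eqxx muln1 /iprefix.
rewrite big_flatten big_map size_flatten /shape sumnE !big_map.
rewrite -[in RHS](big_mkord xpredT (fun k => size (iroots i (F k)))).
have : (\sum_(0 <= k < K) \sum_(v <- ilist i (F k)) v i +
        \sum_(0 <= k < K) size (iroots i (F k)) =
        \sum_(0 <= k < K) size (ilist i (F k)))%N.
  by rewrite -big_split; apply: eq_bigr => k _; exact: ilist_sum.
by rewrite /index_iota subn0 => <-; rewrite PoszD opprD addrA subrr sub0r.
Qed.

(* Completing one more tree that contains type i lowers X^{i,i}. *)
Lemma Xw_diag_liminf (F : nat -> T) i :
  (forall N, exists2 k, (N <= k)%N & (0 < size (iroots i (F k)))%N) ->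
  forall (M : int) (N : nat), exists n, (N <= n)%N /\ Xw F i i n <= M.
Proof.
move=> inf M N.
have H m : exists K, (m <= \sum_(k < K) size (iroots i (F k)))%N.
  elim: m => [|m [K mK]]; first by exists 0%N.
  have [k Kk rk] := inf K; exists k.+1; rewrite big_ord_recr /=.
  rewrite -addn1 leq_add // (leq_trans mK) //.
  rewrite -!(big_mkord xpredT (fun k => size (iroots i (F k)))).
  by rewrite [X in (_ <= X)%N](@big_cat_nat _ _ _ K) //= leq_addr.
(* With this many completed subtrees the walk is at most [M]; as its steps are at least -1, the time
   is at least [N]. *)
have [K NK] := H (N + `|M|)%N.
exists (size (iprefix F i K)); rewrite Xw_diag_iprefix; split; last by lia.
have : -(size (iprefix F i K))%:Z <= Xw F i i (size (iprefix F i K)).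
  rewrite Xw_iprefix eqxx muln1; lia.
rewrite Xw_diag_iprefix; lia.
Qed.

Lemma iprefix_unbounded (F : nat -> T) i :
  (forall N, exists2 k, (N <= k)%N & (0 < size (iroots i (F k)))%N) ->
  forall n, exists K, (n < size (iprefix F i K))%N.
Proof.
move=> inf; elim=> [|n [K nK]].
  have [k _ rk] := inf 0%N; exists k.+1.
  rewrite iprefixE treesS ocode_rcons size_cat -ilist_sum; lia.
have [k Kk rk] := inf K; exists k.+1.
rewrite iprefixE treesS ocode_rcons size_cat -ilist_sum.
rewrite -iprefixE; have [l ->] := iprefix_mono F i Kk; rewrite size_cat; lia.
Qed.

End Coding.

(** * Laws of forests and walks *)

Section Discrete.
Context {dO : measure_display} {O : measurableType dO}.

Lemma measurable_exists (C : countType) (A : C -> O -> Prop) :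
  (forall c, measurable [set w | A c w]) -> measurable [set w | exists c, A c w].
Proof.
move=> mA; rewrite (_ : [set w | _] = \bigcup_c [set w | A c w]).
  by apply: countable_bigcupT_measurable => //; exact: countableP.
by apply/seteqP; split=> [w [c Ac]|w [c _ Ac]]; exists c.
Qed.

Lemma measurable_forall (C : countType) (A : C -> O -> Prop) :
  (forall c, measurable [set w | A c w]) -> measurable [set w | forall c, A c w].
Proof.
move=> mA; rewrite (_ : [set w | _] = ~` [set w | exists c, ~ A c w]).
  apply: measurableC; apply: measurable_exists => c.
  by rewrite (_ : [set w | _] = ~` [set w | A c w]) //; exact: measurableC.
apply/seteqP; split=> [w Aw [c]|w nA c /=]; first exact.
by apply: contrapT => nAc; apply: nA; exists c.
Qed.

Definition discrete_rv (C : countType) (f : O -> C) : Prop :=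
  forall c, measurable [set w | f w = c].

Lemma discrete_rv_set (C : countType) (f : O -> C) (A : C -> Prop) :
  discrete_rv f -> measurable [set w | A (f w)].
Proof.
move=> df; rewrite (_ : [set w | _] = [set w | exists c, f w = c /\ A c]).
  apply: measurable_exists => c; have [Ac|nAc] := pselect (A c).
    by rewrite (_ : [set w | _] = [set w | f w = c]) //; apply/seteqP; split=> w //= [].
  by rewrite (_ : [set w | _] = set0) //; apply/seteqP; split=> w //= [].
by apply/seteqP; split=> [w Aw|w /= [c [-> ]]] //; exists (f w).
Qed.

Lemma discrete_rv_comp (C C' : countType) (g : C -> C') (f : O -> C) :
  discrete_rv f -> discrete_rv (fun w => g (f w)).
Proof. by move=> df c; apply: (discrete_rv_set (fun x => g x = c)). Qed.

Lemma discrete_rv_seq (C : countType) (f : nat -> O -> C) n :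
  (forall k, discrete_rv (f k)) -> discrete_rv (fun w => [seq f k w | k <- iota 0 n]).
Proof.
move=> df; elim: n => [|n IH] s.
  by case: s => [|x s]; [rewrite (_ : [set w | _] = setT) | rewrite (_ : [set w | _] = set0)];
    rewrite ?predeqE.
rewrite (_ : [set w | _] = [set w | [seq f k w | k <- iota 0 n] = take n s] `&`
    [set w | exists x, f n w = x /\ s = rcons (take n s) x]).
  apply: measurableI; first exact: IH.
  by apply: (discrete_rv_set (fun y => exists x, y = x /\ s = rcons (take n s) x)).
have E w : [seq f k w | k <- iota 0 n.+1] = rcons [seq f k w | k <- iota 0 n] (f n w).
  by rewrite -addn1 iotaD map_cat cats1.
apply/seteqP; split => [w Hw|w [Et [x [fx sx]]]].
  have <- : _ = s := Hw.
  rewrite /setI /mkset E -cats1 take_size_cat ?size_map ?size_iota //; split=> //.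
  by exists (f n w); rewrite cats1.
by rewrite /mkset E Et fx -sx.
Qed.

(** The upper bound follows from finite partial sums; for [a] positive, the same bound for the
    inverse of [a] gives the other inequality. *)
Lemma ge0_esumZ (R : realType) (C : choiceType) (a : R) (b : C -> \bar R) (D : set C) :
  0 <= a -> (forall c, (0 <= b c)%E) ->
  (\esum_(c in D) (a%:E * b c) = a%:E * \esum_(c in D) b c)%E.
Proof.
have le (x : R) (f : C -> \bar R) : 0 < x -> (forall c, (0 <= f c)%E) ->
    (\esum_(c in D) (x%:E * f c) <= x%:E * \esum_(c in D) f c)%E.
  move=> x0 f0; apply: ge_ereal_sup => _ [X [finX XD] <-].
  rewrite -ge0_mule_fsumr //; apply: lee_wpmul2l; first by rewrite lee_fin ltW.
  by apply: esum_ge; exists X.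
rewrite le_eqVlt => /orP[/eqP <- b0|a0 b0].
  by rewrite mul0e esum1 // => i _; rewrite mul0e.
apply/eqP; rewrite eq_le le //=.
rewrite -lee_pdivlMl //; apply: le_trans (le _ _ _ _); rewrite ?invr_gt0 //.
  by apply: le_esum => c _; rewrite muleA -EFinM mulVf ?gt_eqF // mul1e.
by move=> c; apply: mule_ge0 => //; rewrite lee_fin ltW.
Qed.

Context {R : realType} (P : probability O R).

Lemma measure_empty (A : O -> Prop) : (forall w, ~ A w) -> P [set w | A w] = 0%E.
Proof.
by move=> nA; rewrite (_ : [set w | A w] = set0) ?measure0 //; apply/seteqP; split=> w // /nA.
Qed.

(** Countable additivity along [pickle]; integers that code no element give the empty set. *)
Lemma measure_disjoint_exists (C : countType) (A : C -> O -> Prop) :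
  (forall c, measurable [set w | A c w]) ->
  (forall c c' w, A c w -> A c' w -> c = c') ->
  P [set w | exists c, A c w] = \esum_(c in [set: C]) P [set w | A c w].
Proof.
move=> mA tA.
pose G n := [set w | exists c, pickle c = n /\ A c w].
have mG n : measurable (G n).
  apply: measurable_exists => c; have [->|nc] := eqVneq (pickle c) n.
    by rewrite (_ : [set w | _] = [set w | A c w]) //; apply/seteqP; split=> w //= [].
  rewrite (_ : [set w | _] = set0) //; apply/seteqP; split=> w //= [E].
  by rewrite E eqxx in nc.
have -> : [set w | exists c, A c w] = \bigcup_n G n.
  apply/seteqP; split=> [w [c Ac]|w [n _ [c [_ Ac]]]]; last by exists c.
  by exists (pickle c) => //; exists c.
rewrite measure_bigcup //; last first.
  move=> n m _ _ [w [[c [cn Ac]] [c' [cm Ac']]]].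
  by rewrite -cn -cm (tA _ _ _ Ac Ac').
have GE c : G (pickle c) = [set w | A c w].
  apply/seteqP; split=> [w [c' [/(pcan_inj pickleK) <-]]|w Ac] //.
  by exists c.
rewrite nneseries_esum //.
have <- : \esum_(n in pickle @` [set: C]) P (G n) = \esum_(c in [set: C]) P [set w | A c w].
  rewrite esum_image; last by move=> x y _ _ /(pcan_inj pickleK).
  by apply: eq_esum => c _; rewrite GE.
rewrite esum_mkcond [RHS]esum_mkcond; apply: eq_esum => n _.
rewrite [in LHS]mem_set; last exact/mem_set.
case: ifPn => // /negP nn; rewrite (_ : G n = set0) ?measure0 //.
apply/seteqP; split=> w //= [c [cn _]]; apply: nn; rewrite inE; exists c => //.
Qed.

Lemma measure_partition (C : countType) (f : O -> C) (A : O -> Prop) :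
  discrete_rv f -> measurable [set w | A w] ->
  P [set w | A w] = \esum_(c in [set: C]) P [set w | f w = c /\ A w].
Proof.
move=> df mA; rewrite -(measure_disjoint_exists (A := fun c w => f w = c /\ A w)).
- by congr (P _); apply/seteqP; split=> [w Aw|w [c []]] //; exists (f w).
- by move=> c; exact: (measurableI _ _ (df c) mA).
- by move=> c c' w [<- _] [].
Qed.

(** Negligible complements make the notion stable under consequences without a measurability
    check. *)
Definition almost_surely (A : O -> Prop) : Prop := P.-negligible (~` [set w | A w]).

Lemma as_prob1 (A : O -> Prop) : measurable [set w | A w] ->
  almost_surely A <-> P [set w | A w] = 1%E.
Proof.
move=> mA; have mC := measurableC mA; rewrite /almost_surely; split=> H.
  have := probability_setC P mC; rewrite setCK => ->.
  by rewrite (measure_negligible mC H) sube0.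
exists (~` [set w | A w]); split=> //.
by have -> := probability_setC P mA; rewrite H subee.
Qed.

Lemma as_S (A B : O -> Prop) : (forall w, A w -> B w) -> almost_surely A -> almost_surely B.
Proof. by move=> AB; apply: negligibleS; apply: subsetC => w; exact: AB. Qed.

Lemma as_I (A B : O -> Prop) : almost_surely A -> almost_surely B -> almost_surely (fun w => A w /\ B w).
Proof.
move=> nA nB; apply: negligibleS (negligibleU nA nB) => w /= /not_andP[].
  by left.
by right.
Qed.

Lemma as_forall (C : countType) (A : C -> O -> Prop) :
  (forall c, almost_surely (A c)) -> almost_surely (fun w => forall c, A c w).
Proof.
move=> nA; pose G n : O -> Prop := fun w => if unpickle n is Some c then A c w else True.
have nG n : P.-negligible (~` [set w | G n w]).
  rewrite /G; case: (unpickle n) => [c|]; first exact: nA.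
  rewrite (_ : ~` _ = set0); first exact: negligible_set0.
  by apply/seteqP; split=> w //=; apply.
apply: negligibleS (negligible_bigcup nG) => w /= nAw.
apply: contrapT => H; apply: nAw => c.
apply: contrapT => nAc; apply: H; exists (pickle c) => //=.
by rewrite /G pickleK.
Qed.

Lemma as_eq (A B : O -> Prop) : measurable [set w | A w] -> measurable [set w | B w] ->
  almost_surely (fun w => A w <-> B w) -> P [set w | A w] = P [set w | B w].
Proof.
move=> mA mB AB.
have H X Y : measurable [set w | X w] -> measurable [set w | Y w] ->
    almost_surely (fun w => X w <-> Y w) -> (P [set w | X w] <= P [set w | Y w])%E.
  move=> mX mY XY.
  rewrite (measureDI P mX mY) (@measure_negligible _ _ _ P (_ `\` _)).
  - by rewrite add0e measureIr.
  - exact: measurableD.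
  by apply: negligibleS XY => w /= [Xw nYw] [/(_ Xw)].
apply/eqP; rewrite eq_le !H //.
by apply: as_S AB => w [].
Qed.

End Discrete.

(** * Weights of trees and of finite forests *)

Section Weights.
Variables (R : realType) (d : nat).
Local Notation T := (ttree d).
Local Notation V := {ffun 'I_d -> nat}.
Variable nu : 'I_d -> V -> R.
Hypothesis hnu : is_progeny_law nu.

Let nu_ge0 i v : 0 <= nu i v. Proof. exact: (proj1 hnu). Qed.

Lemma tweightE (t : T) :
  tweight nu t = nu (ttype t) (pvec t) * \prod_(c <- tchildren t) tweight nu c.
Proof.
case: t => a cs /=; congr (_ * _); elim: cs => [|c cs IH]; first by rewrite big_nil.
by rewrite big_cons -IH.
Qed.

Lemma tweight_verts (t : T) : tweight nu t = \prod_(u <- verts t) nu (ttype u) (pvec u).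
Proof.
elim/ttree_mem_ind: t => a cs IH.
rewrite tweightE vertsE big_cons; congr (_ * _) => /=.
by rewrite big_flatten big_map big_seq [RHS]big_seq; apply: eq_bigr => c /IH.
Qed.

(** Grouping the vertices by type turns the weight of a tree into a product over the steps read from
    its codes. *)
Lemma tweight_ilist (t : T) : tweight nu t = \prod_i \prod_(v <- ilist i t) nu i v.
Proof.
rewrite tweight_verts.
under [RHS]eq_bigr do rewrite (perm_big _ (ilist_perm _ _)) big_map big_filter.
rewrite (exchange_big_dep xpredT) //=; apply: eq_bigr => u _.
by rewrite (big_pred1 (ttype u)) // => i; rewrite eq_sym.
Qed.

Lemma tweight_ge0 (t : T) : 0 <= tweight nu t.
Proof. by rewrite tweight_verts; apply: prodr_ge0 => u _. Qed.

Lemma tree_law_ge0 i (t : T) : 0 <= tree_law nu i t.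
Proof. by rewrite /tree_law; case: ifP => // _; exact: tweight_ge0. Qed.

(** The lists with which a forest of root types [c] can start; all others have weight 0. *)
Definition valid (c : nat -> 'I_d) (s : seq T) : bool :=
  all (@twf d) s && (map (@ttype d) s == [seq c k | k <- iota 0 (size s)]).

Lemma valid_rcons c s t :
  valid c (rcons s t) = valid c s && ((ttype t == c (size s)) && twf t).
Proof.
rewrite /valid all_rcons map_rcons size_rcons -[(size s).+1]addn1 iotaD map_cat add0n.
rewrite cats1 eqseq_rcons.
by case: (twf t) (all _ s) (_ == _) (_ == _) => [] [] [] [].
Qed.

Definition forest_wt (c : nat -> 'I_d) (s : seq T) : R :=
  \prod_(k < size s) tree_law nu (c k) (nth (TNode (c 0%N) [::]) s k).

Lemma forest_wt_rcons c s t :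
  forest_wt c (rcons s t) = forest_wt c s * tree_law nu (c (size s)) t.
Proof.
rewrite /forest_wt size_rcons big_ord_recr /= nth_rcons ltnn eqxx; congr (_ * _).
by apply: eq_bigr => k _; rewrite nth_rcons ltn_ord.
Qed.

Lemma forest_wt_ge0 c s : 0 <= forest_wt c s.
Proof. by apply: prodr_ge0 => k _; exact: tree_law_ge0. Qed.

Lemma forest_wtE c s :
  forest_wt c s = if valid c s then \prod_(t <- s) tweight nu t else 0.
Proof.
elim/last_ind: s => [|s t IH]; first by rewrite /forest_wt big_ord0 /valid /= big_nil.
rewrite forest_wt_rcons valid_rcons IH big_rcons /tree_law /=.
case: (valid c s); rewrite ?mul0r //=.
by case: ifP; rewrite ?mulr0 // mulrC.
Qed.

Lemma forest_wt_code c s : valid c s ->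
  forest_wt c s = \prod_i \prod_(v <- ocode i s) nu i v.
Proof.
rewrite forest_wtE => ->; elim: s => [|t s IH].
  by rewrite big_nil big1 // => i _; rewrite /ocode big_nil.
rewrite big_cons IH tweight_ilist -big_split; apply: eq_bigr => i _.
by rewrite ocode_cons big_cat.
Qed.

Lemma code_valid_inj c s s' : valid c s -> valid c s' -> size s = size s' ->
  (forall i, compatible (ocode i s) (ocode i s')) -> s = s'.
Proof.
move=> /andP[w /eqP t] /andP[w' /eqP t'] ss.
by apply: ocode_inj => //; rewrite t t' ss.
Qed.

Lemma valid_take c s k : valid c s -> valid c (take k s).
Proof.
move=> /andP[/allP w /eqP t]; apply/andP; split.
  by apply/allP => x /mem_take; exact: w.
rewrite map_take t -map_take size_take_min take_iota.
by rewrite minnC.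
Qed.

End Weights.

(** * The law of the first trees of a branching forest *)

Section ForestLaw.
Variables (R : realType) (d : nat).
Local Notation T := (ttree d).
Local Notation V := {ffun 'I_d -> nat}.
Variable nu : 'I_d -> V -> R.
Hypothesis hnu : is_progeny_law nu.
Context {dO : measure_display} {O : measurableType dO}.
Variables (P : probability O R) (F : O -> nat -> T) (c : nat -> 'I_d).
Hypothesis hF : branching_forest nu P F c.

Lemma discrete_tree k : discrete_rv (F^~ k).
Proof. by move=> t; exact: (proj1 hF). Qed.

Lemma discrete_trees n : discrete_rv (fun w => trees (F w) n).
Proof. by apply: discrete_rv_seq; exact: discrete_tree. Qed.

Lemma trees_law n s : size s = n ->
  P [set w | trees (F w) n = s] = (forest_wt nu c s)%:E.
Proof.
move=> sn; rewrite /forest_wt sn -(proj2 hF n (nth (TNode (c 0%N) [::]) s)).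
congr (P _); apply/seteqP; split=> w /= H.
  by move=> k kn; rewrite -H nth_trees.
apply: (@eq_from_nth _ (TNode (c 0%N) [::])); first by rewrite size_trees.
by move=> k; rewrite size_trees => kn; rewrite nth_trees // H.
Qed.

Lemma measurable_trees n (A : seq T -> Prop) : measurable [set w | A (trees (F w) n)].
Proof. exact: discrete_rv_set (discrete_trees n). Qed.

Lemma trees_set_law n (A : seq T -> Prop) :
  P [set w | A (trees (F w) n)] =
  \esum_(s in [set s | size s = n /\ A s]) (forest_wt nu c s)%:E.
Proof.
rewrite (measure_partition P (discrete_trees n) (measurable_trees _ A)) [RHS]esum_mkcond.
apply: eq_esum => s _; case: ifPn => [/set_mem[sn As]|/negP ns].
  rewrite -(trees_law sn); congr (P _); apply/seteqP; split=> w //= [] //.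
  by move=> ->.
rewrite measure_empty // => w [ws].
by rewrite ws => As; apply: ns; rewrite inE; split=> //; rewrite -ws size_trees.
Qed.

(** Independence of the next tree, by splitting over the values of the first [n] trees. *)
Lemma trees_next_law n (A : seq T -> Prop) (t : T) :
  P [set w | A (trees (F w) n) /\ F w n = t] =
  (P [set w | A (trees (F w) n)] * (tree_law nu (c n) t)%:E)%E.
Proof.
have m2 : measurable [set w | A (trees (F w) n) /\ F w n = t].
  by apply: measurableI; [exact: measurable_trees|exact: discrete_tree].
rewrite (measure_partition P (discrete_trees n) m2).
rewrite (measure_partition P (discrete_trees n) (measurable_trees _ A)).
rewrite muleC -ge0_esumZ ?tree_law_ge0 //; apply: eq_esum => s _.
have [sn|/eqP sn] := eqVneq (size s) n; last first.
  rewrite !measure_empty ?mule0 // => w [ws _]; apply: sn;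
    by rewrite -ws size_trees.
have [As|nAs] := pselect (A s); last first.
  by rewrite !measure_empty ?mule0 // => w [ws]; rewrite ?ws // => -[].
transitivity (P [set w | trees (F w) n.+1 = rcons s t]).
  congr (P _); apply/seteqP; split=> w.
    by move=> [Ew [_ Et]]; rewrite /mkset treesS Ew Et.
  by rewrite /mkset treesS => /rcons_inj[-> ->].
rewrite (@trees_law n.+1) ?size_rcons ?sn // forest_wt_rcons sn EFinM muleC; congr (_ * _)%E.
rewrite -(trees_law sn); congr (P _); apply/seteqP; split=> w //= [] //.
by move=> ->.
Qed.

Lemma tree_law_le1 n t : tree_law nu (c n) t <= 1.
Proof.
rewrite -lee_fin; have := trees_next_law n (fun=> True) t.
rewrite (_ : [set w | True] = setT) // probability_setT mul1e => <-.
apply: probability_le1; rewrite (_ : [set w | _] = [set w | F w n = t]).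
  exact: discrete_tree.
by apply/seteqP; split=> w //= [].
Qed.

Lemma trees_next_set_law n (A : seq T -> Prop) (B : T -> Prop) :
  P [set w | A (trees (F w) n) /\ B (F w n)] =
  (P [set w | A (trees (F w) n)] * \esum_(t in [set t | B t]) (tree_law nu (c n) t)%:E)%E.
Proof.
have mB : measurable [set w | B (F w n)] := discrete_rv_set B (discrete_tree n).
rewrite (measure_partition P (discrete_tree n)); last exact: measurableI (measurable_trees _ A) mB.
have fA : P [set w | A (trees (F w) n)] \is a fin_num.
  by rewrite fin_num_measure //; exact: measurable_trees.
rewrite -(fineK fA) [X in (_ * X)%E]esum_mkcond -ge0_esumZ ?fine_ge0 //; last first.
  by move=> t; case: ifP => // _; rewrite lee_fin; exact: tree_law_ge0.
apply: eq_esum => t _; rewrite fineK //; case: ifPn => [/set_mem Bt|/negP nBt].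
  rewrite -trees_next_law; congr (P _); apply/seteqP; split=> w /=.
    by move=> [Et [Aw _]].
  by move=> [Aw ->].
rewrite mule0 measure_empty // => w [-> [_ Bt]].
by apply: nBt; rewrite inE.
Qed.

(** The weights are the law of the first [n] trees of [F], which are finite trees; almost sure
    extinction enters here. *)
Lemma esum_forest_wt n : \esum_(s in [set s | size s = n]) (forest_wt nu c s)%:E = 1%E.
Proof.
have := trees_set_law n (fun=> True).
rewrite (_ : [set w | True] = setT) // probability_setT => ->.
by congr esum; apply/seteqP; split=> s //= [].
Qed.

Lemma esum_forest_wt_valid n :
  \esum_(s in [set s | size s = n /\ valid c s]) (forest_wt nu c s)%:E = 1%E.
Proof.
rewrite -(esum_forest_wt n) esum_mkcond [RHS]esum_mkcond; apply: eq_esum => s _.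
case: ifPn => [/set_mem[sn vs]|/negP ns]; first by rewrite mem_set.
case: ifPn => // /set_mem sn; rewrite forest_wtE; case: ifP => // vs.
by exfalso; apply: ns; rewrite inE.
Qed.

Lemma as_valid : almost_surely P (fun w => forall n, valid c (trees (F w) n)).
Proof.
apply: as_forall => n; apply/as_prob1; first exact: (measurable_trees n (fun s => valid c s)).
by rewrite (trees_set_law n (fun s => valid c s)) esum_forest_wt_valid.
Qed.

(* Each tree of the forest equals the prescribed tree of its root type with
   probability at least [p], the least of finitely many positive weights. *)
Lemma as_infinitely_often (B : T -> Prop) (tt : 'I_d -> T) :
  (forall j, B (tt j)) -> (forall j, 0 < tree_law nu j (tt j)) ->
  almost_surely P (fun w => forall N, exists2 k, (N <= k)%N & B (F w k)).
Proof.
move=> Btt wtt.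
have [p p0 ple] : exists2 p, 0 < p & forall j, p <= tree_law nu j (tt j).
  exists (\big[Num.min/1]_j tree_law nu j (tt j)).
    by elim/big_ind: _ => // x y x0 y0; rewrite lt_min x0.
  by move=> j; rewrite bigmin_le_cond.
have p1 : p <= 1 by exact: le_trans (ple (c 0%N)) (tree_law_le1 0 _).
apply: as_forall => N.
pose A m (s : seq T) := forall k, (N <= k < N + m)%N -> nth (tt (c k)) s k <> tt (c k).
have PA m : (P [set w | A m (trees (F w) (N + m))] <= ((1 - p) ^+ m)%:E)%E.
  elim: m => [|m IH]; first by rewrite expr0; apply: probability_le1; exact: measurable_trees.
  (* One more miss removes the event that the next tree is the prescribed one, of conditional
     probability at least [p]. *)
  have E : [set w | A m.+1 (trees (F w) (N + m.+1))] =
    [set w | A m (trees (F w) (N + m))] `\`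
      [set w | A m (trees (F w) (N + m)) /\ F w (N + m)%N = tt (c (N + m)%N)].
    apply/seteqP; split=> w; rewrite /mkset /A.
      move=> H; split.
        move=> k kNm; have := H k; rewrite !nth_trees; first by apply; lia.
        - by lia.
        - by lia.
      by move=> [_]; have := H (N + m)%N; rewrite nth_trees; [apply; lia|lia].
    move=> [H1 H2] k kNm; rewrite nth_trees; last by lia.
    have [->|kn] := eqVneq k (N + m)%N; first by move=> Ek; apply: H2.
    have := H1 k; rewrite nth_trees; last by lia.
    by apply; lia.
  have mA := measurable_trees (N + m) (A m).
  have mA2 : measurable [set w | A m (trees (F w) (N + m)) /\ F w (N + m)%N = tt (c (N + m)%N)].
    by apply: measurableI => //; exact: discrete_tree.
  have fA : P [set w | A m (trees (F w) (N + m))] \is a fin_num by rewrite fin_num_measure.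
  have D := trees_next_law (N + m) (A m) (tt (c (N + m)%N)).
  have -> : P [set w | A m.+1 (trees (F w) (N + m.+1))] =
    (P [set w | A m (trees (F w) (N + m))] -
     P [set w | A m (trees (F w) (N + m)) /\ F w (N + m)%N = tt (c (N + m)%N)])%E.
    rewrite E measureD //; last by apply: le_lt_trans (probability_le1 P mA) _; rewrite ltry.
    by congr (_ - P _)%E; rewrite setIidr // => w [].
  rewrite D; move: IH; rewrite -(fineK fA) -EFinM -EFinB !lee_fin exprS => IH.
  have x0 : 0 <= fine (P [set w | A m (trees (F w) (N + m))]) by rewrite fine_ge0.
  have := ple (c (N + m)%N); set q := tree_law _ _ _; set x := fine _ in IH x0 * => pq.
  rewrite -{1}[x]mulr1 -mulrBr mulrC; apply: ler_pM => //.
    by rewrite subr_ge0 tree_law_le1.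
  by rewrite lerB.
have mH : measurable [set w | exists2 k, (N <= k)%N & B (F w k)].
  rewrite (_ : [set w | _] = [set w | exists k, (N <= k)%N /\ B (F w k)]).
    apply: measurable_exists => k.
    exact: (discrete_rv_set (fun t => (N <= k)%N /\ B t) (discrete_tree k)).
  by apply/seteqP; split=> [w [k]|w [k []]]; exists k.
have mC := measurableC mH.
have fC : P (~` [set w | exists2 k, (N <= k)%N & B (F w k)]) \is a fin_num.
  by rewrite fin_num_measure.
exists (~` [set w | exists2 k, (N <= k)%N & B (F w k)]); split=> //.
apply/eqP; rewrite eq_le measure_ge0 andbT -(fineK fC) lee_fin.
(* Missing forever has probability at most [(1 - p) ^+ m] for every [m]. *)
have cv : (fun m => (1 - p) ^+ m) @ \oo --> (0 : R).
  by apply: cvg_expr; rewrite ger0_norm ?subr_ge0 // ltrBlDr ltrDl.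
rewrite -(cvg_lim _ cv) //; apply: limr_ge; first by apply/cvg_ex; exists 0.
apply: nearW => m; rewrite -lee_fin (fineK fC); apply: le_trans (PA m).
apply: le_measure; rewrite ?inE //; first exact: (measurable_trees _ (A m)).
move=> w nH k /andP[Nk kNm]; rewrite nth_trees // => Fk.
by apply: nH; exists k; rewrite ?Fk.
Qed.

End ForestLaw.

(** * Laws of independent walks *)

Section StepLaw.
Variables (R : realType) (d : nat).
Local Notation V := {ffun 'I_d -> nat}.
Local Notation Q := {ffun 'I_d -> int}.
Variable nu : 'I_d -> V -> R.
Hypothesis hnu : is_progeny_law nu.

Lemma step_law_stepv i v : step_law nu i (stepv i v) = nu i v.
Proof.
rewrite /step_law; case: ifPn => [_|/forallPn[j]]; last first.
  by rewrite ffunE subrK.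
by congr nu; apply/ffunP => j; rewrite !ffunE subrK absz_nat.
Qed.

Lemma step_law_eq0 i (q : Q) : (forall v, q <> stepv i v) -> step_law nu i q = 0.
Proof.
move=> nq; rewrite /step_law; case: ifPn => // /forallP q0; exfalso.
apply: (nq [ffun j => absz (q j + (i == j)%:Z)]); apply/ffunP => j.
by rewrite !ffunE gez0_abs ?addrK.
Qed.

Lemma step_law_ge0 i q : 0 <= step_law nu i q.
Proof. by rewrite /step_law; case: ifP => // _; exact: (proj1 hnu). Qed.

Lemma esum_step_law i : \esum_(q in [set: Q]) (step_law nu i q)%:E = 1%E.
Proof.
rewrite -(proj2 hnu i); transitivity (\esum_(q in stepv i @` [set: V]) (step_law nu i q)%:E).
  rewrite esum_mkcond [RHS]esum_mkcond; apply: eq_esum => q _.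
  rewrite [in LHS]mem_set //; case: ifPn => // /negP nq.
  rewrite step_law_eq0 // => v qv; apply: nq; rewrite inE; exists v => //.
rewrite esum_image; last by move=> v v' _ _ /stepv_inj.
by apply: eq_esum => v _; rewrite step_law_stepv.
Qed.

Context {dO : measure_display} {O : measurableType dO}.
Variable P : probability O R.

(** If all prescribed steps come from offspring vectors, the event is translated by [stepv];
    otherwise it is empty and a factor of the product is 0. *)
Lemma walk_law_of_steps (Y : O -> 'I_d -> nat -> Q) (U : O -> 'I_d -> nat -> V) :
  (forall w i m, Y w i m.+1 - Y w i m = stepv i (U w i m)) ->
  (forall n (v : 'I_d -> nat -> V),
     P [set w | forall i m, (m < n)%N -> U w i m = v i m] =
     (\prod_(i < d) \prod_(m < n) nu i (v i m))%:E) ->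
  forall n (q : 'I_d -> nat -> Q),
    P [set w | forall i m, (m < n)%N -> Y w i m.+1 - Y w i m = q i m] =
    (\prod_(i < d) \prod_(m < n) step_law nu i (q i m))%:E.
Proof.
move=> YU HU n q.
have [H|] := pselect (forall i m, (m < n)%N -> exists v, q i m = stepv i v).
  have [v vE] : exists v : 'I_d -> nat -> V,
      forall i m, (m < n)%N -> q i m = stepv i (v i m).
    exists (fun i m => if pselect (exists v, q i m = stepv i v) is left h
                       then projT1 (cid h) else [ffun=> 0%N]).
    move=> i m mn; case: pselect => [h|[]]; first by case: cid.
    exact: H.
  under [in RHS]eq_bigr do under eq_bigr do rewrite vE // step_law_stepv.
  rewrite -HU; congr (P _); apply/seteqP; split=> w Hw i m mn.
    by apply: (@stepv_inj _ i); rewrite -YU -vE // Hw.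
  by rewrite YU vE // Hw.
move=> /existsNP[i /existsNP[m /not_implyP[mn nv]]].
have q0 : step_law nu i (q i m) = 0.
  by apply: step_law_eq0 => v qv; apply: nv; exists v.
rewrite measure_empty; last first.
  by move=> w /(_ i m mn); rewrite YU => qv; apply: nv; exists (U w i m).
rewrite (bigD1 i) //= (bigD1 (Ordinal mn)) //= q0.
by rewrite !mul0r.
Qed.

Variable Y : O -> 'I_d -> nat -> Q.
Hypothesis hY : indep_walks_law nu P Y.

(** The lists may have unequal lengths, since the code of a finite forest can end at a different
    time for each type. *)
Definition starts_with (l : 'I_d -> seq Q) (w : O) : Prop :=
  forall i m, (m < size (l i))%N -> Y w i m.+1 - Y w i m = nth 0 (l i) m.

Lemma discrete_step i m : discrete_rv (fun w => Y w i m.+1 - Y w i m).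
Proof.
have dY n : discrete_rv (fun w => Y w i n) by move=> z; exact: (proj1 hY).
move=> q; rewrite (_ : [set w | _] =
   [set w | exists z, Y w i m = z /\ Y w i m.+1 = q + z]).
  by apply: measurable_exists => z; exact: (measurableI _ _ (dY m z) (dY m.+1 (q + z))).
apply/seteqP; split=> w /=; first by move=> <-; exists (Y w i m); rewrite subrK.
by move=> [z [-> ->]]; rewrite addrK.
Qed.

Lemma measurable_starts_with l : measurable [set w | starts_with l w].
Proof.
apply: measurable_forall => i; apply: measurable_forall => m.
exact: (discrete_rv_set (fun q => (m < size (l i))%N -> q = nth 0 (l i) m) (@discrete_step i m)).
Qed.

(* Induction on the number of steps missing from [l] before a common horizon
   [n], at which the hypothesis on the joint law applies. *)
Lemma starts_with_law l :
  P [set w | starts_with l w] = (\prod_i \prod_(q <- l i) step_law nu i q)%:E.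
Proof.
have [n ln] : exists n, forall i, (size (l i) <= n)%N.
  by exists (\max_i size (l i)) => i; exact: leq_bigmax.
have [k] := ubnP (\sum_i (n - size (l i)))%N; elim: k => // k IH in l ln *.
move=> lk; have [H|/existsNP[i /eqP ni]] := pselect (forall i, (n - size (l i))%N = 0%N).
  have sn i : size (l i) = n by apply/eqP; rewrite eqn_leq ln -subn_eq0 H.
  have := proj2 (proj2 hY) n (fun i m => nth 0 (l i) m).
  rewrite (_ : [set w | _] = [set w | starts_with l w]); last first.
    by apply/seteqP; split=> w Hw i m mn; apply: Hw; move: mn; rewrite sn.
  move=> ->; congr EFin; apply: eq_bigr => i _.
  by rewrite (big_nth 0) big_mkord sn.
(* One more step is prescribed for walk [i]; summing over its value [q] gives a factor of total mass
   1. *)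
pose l' q j := if j == i then rcons (l i) q else l j.
have sl' q j : size (l' q j) = (size (l j) + (j == i))%N.
  by rewrite /l'; case: eqVneq => [->|]; rewrite ?size_rcons ?addn1 ?addn0.
rewrite (measure_partition P (@discrete_step i (size (l i))) (measurable_starts_with l)).
rewrite -[RHS]mule1 -(esum_step_law i) -ge0_esumZ.
- apply: eq_esum => q _; transitivity (P [set w | starts_with (l' q) w]).
    congr (P _); apply/seteqP; split=> w.
      move=> [wq Hw] j m; rewrite sl' /l'; case: eqVneq => [->|_]; last by rewrite addn0; exact: Hw.
      rewrite addn1 ltnS leq_eqVlt nth_rcons => /orP[/eqP->|ml].
        by rewrite ltnn eqxx.
      by rewrite ml; exact: Hw.
    move=> Hw; split.
      have := Hw i (size (l i)); rewrite sl' /l' !eqxx addn1 nth_rcons ltnn eqxx.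
      exact.
    move=> j m ml; have := Hw j m; rewrite sl' /l'; case: eqVneq => [ji|_].
      by rewrite -ji nth_rcons ml addn1; apply; exact: ltnW.
    by rewrite addn0; exact.
  rewrite IH.
  + rewrite -EFinM; congr EFin; rewrite (bigD1 i) //= [in RHS](bigD1 i) //= /l' eqxx.
    rewrite (eq_bigr (fun j => \prod_(x <- l j) step_law nu j x)); last by move=> j /negbTE ->.
    by rewrite big_rcons /= mulrAC.
  + by move=> j; rewrite sl'; case: eqVneq => [->|_]; have := ln j; have := ln i; lia.
  rewrite -ltnS; apply: leq_trans lk; rewrite ltnS.
  rewrite (bigD1 i) //= [X in (_ < X)%N](bigD1 i) //= sl' eqxx.
  rewrite -addSn leq_add //; first by lia.
  by apply: leq_sum => j ji; rewrite sl' (negbTE ji) addn0.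
- by apply: prodr_ge0 => j _; apply: prodr_ge0 => q _; exact: step_law_ge0.
by move=> q; rewrite lee_fin step_law_ge0.
Qed.

End StepLaw.

(** * Offspring of the roots and a realization of the walks *)

Section OffspringLaw.
Variables (R : realType) (d : nat).
Local Notation T := (ttree d).
Local Notation V := {ffun 'I_d -> nat}.
Variable nu : 'I_d -> V -> R.
Hypothesis hnu : is_progeny_law nu.
Context {dO : measure_display} {O : measurableType dO}.
Variables (Pc : (nat -> 'I_d) -> probability O R) (F : O -> nat -> T).
Hypothesis hF : forall c, branching_forest nu (Pc c) F c.

(** The only nondecreasing sequence of child types with offspring vector [v]. *)
Definition sorted_types (v : V) : seq 'I_d :=
  sort (fun x y : 'I_d => (x <= y)%N) (flatten [seq nseq (v a) a | a <- enum 'I_d]).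

Lemma count_sorted_types v a : count (pred1 a) (sorted_types v) = v a.
Proof.
rewrite count_sort count_flatten -map_comp sumnE big_map big_enum /=.
rewrite (bigD1 a) //= count_nseq /= eqxx mul1n big1 ?addn0 // => b ba.
by rewrite count_nseq /= (negbTE ba).
Qed.

Lemma sorted_sorted_types v : sorted (fun x y : 'I_d => (x <= y)%N) (sorted_types v).
Proof. by apply: sort_sorted => x y; exact: leq_total. Qed.

Lemma offv_types (cs : seq T) v : map (@ttype d) cs = sorted_types v -> offv cs = v.
Proof.
move=> E; apply/ffunP => a; rewrite ffunE -(count_sorted_types v a) -E count_map.
by apply: eq_count.
Qed.

Lemma sorted_offv (cs : seq T) v : offv cs = v ->
  sorted (fun x y => (ttype x <= ttype y)%N) cs = (map (@ttype d) cs == sorted_types v).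
Proof.
move=> E; apply/idP/eqP => [S|E']; last first.
  have := sorted_sorted_types v; rewrite -E' sorted_map; exact.
apply: (@sorted_eq _ (fun x y : 'I_d => (x <= y)%N)).
- by move=> x y z; exact: leq_trans.
- by move=> x y H; apply: val_inj; apply/eqP; rewrite eqn_leq.
- by rewrite sorted_map.
- exact: sorted_sorted_types.
apply/allP => a _ /=; rewrite count_sorted_types -E ffunE count_map.
by apply/eqP; apply: eq_count.
Qed.

(** The children of the root form a finite forest with root types [c]; if they are out of order,
    both sides vanish. *)
Lemma tree_law_node i (cs : seq T) c : size cs = size (sorted_types (offv cs)) ->
  (forall k, (k < size cs)%N -> c k = nth i (sorted_types (offv cs)) k) ->
  tree_law nu i (TNode i cs) = nu i (offv cs) * forest_wt nu c cs.
Proof.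
move=> sz cE; rewrite /tree_law twfE tweightE /= eqxx /=.
rewrite (sorted_offv (erefl (offv cs))) forest_wtE /valid andbC.
rewrite (_ : [seq c k | k <- _] = sorted_types (offv cs)); last first.
  rewrite sz -[RHS](mkseq_nth i); apply/eq_in_map => k.
  by rewrite mem_iota add0n -sz => /andP[_ /cE].
by case: ifP; rewrite ?mulr0.
Qed.

(* Summing out the subtrees of the root: they form an initial piece of a
   branching forest, whatever their number and types are. *)
Lemma offspring_law i v :
  \esum_(t in [set t | pvec t = v]) (tree_law nu i t)%:E = (nu i v)%:E.
Proof.
(* The child types prescribed by [v], continued by the default [i]. *)
pose c k := nth i (sorted_types v) k.
rewrite -[RHS]mule1 -(esum_forest_wt (hF c) (size (sorted_types v))).
rewrite -ge0_esumZ; [|exact: (proj1 hnu)|by move=> s; rewrite lee_fin forest_wt_ge0].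
transitivity (\esum_(t in TNode i @` [set cs | offv cs = v]) (tree_law nu i t)%:E).
  rewrite esum_mkcond [RHS]esum_mkcond; apply: eq_esum => t _.
  case: ifPn => [/set_mem tv|/negP ntv]; case: ifPn => [/set_mem tcs|/negP ntcs] //.
  - rewrite /tree_law; case: ifPn => // /andP[/eqP ti _].
    exfalso; apply: ntcs; rewrite inE; exists (tchildren t) => //.
    by case: t ti {tv} => a cs /= ->.
  - by exfalso; apply: ntv; rewrite inE; case: tcs => cs csv <-.
rewrite esum_image; last by move=> x y _ _ [].
rewrite esum_mkcond [RHS]esum_mkcond; apply: eq_esum => cs _.
case: ifPn => [/set_mem /= csv|/negP ncs].
  have scs : size cs = size (sorted_types v).
    have E (s : seq 'I_d) : size s = (\sum_a count (pred1 a) s)%N.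
      elim: s => [|x s IH]; first by rewrite big1.
      rewrite /= big_split -IH /= (bigD1 x) //= eqxx big1 // => b.
      by rewrite eq_sym => /negbTE ->.
    rewrite -(size_map (@ttype d)) !E; apply: eq_bigr => a _.
    rewrite count_sorted_types -csv ffunE count_map; exact: eq_count.
  rewrite mem_set //= (@tree_law_node i cs c) ?csv // EFinM //.
case: ifPn => // /set_mem /= scs.
rewrite forest_wtE; case: ifPn => [/andP[_ /eqP tcs]|]; last by rewrite mule0.
exfalso; apply: ncs; rewrite inE /=; apply: offv_types.
by rewrite tcs scs -[RHS](mkseq_nth i).
Qed.

Lemma root_offspring_law c n (v : nat -> V) :
  Pc c [set w | forall k, (k < n)%N -> pvec (F w k) = v k] =
  (\prod_(k < n) nu (c k) (v k))%:E.
Proof.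
pose A n (s : seq T) := forall k, (k < n)%N -> pvec (nth (TNode (c 0%N) [::]) s k) = v k.
have AE m w : A m (trees (F w) m) <-> forall k, (k < m)%N -> pvec (F w k) = v k.
  by split=> H k kn; have := H k kn; rewrite nth_trees.
elim: n => [|n IH].
  by rewrite big_ord0 -(probability_setT (Pc c)); congr (Pc c _); apply/seteqP; split.
rewrite big_ord_recr /= EFinM -IH -offspring_law.
rewrite (_ : [set w | forall k, (k < n)%N -> _] = [set w | A n (trees (F w) n)]); last first.
  by apply/seteqP; split=> w /AE.
rewrite -(trees_next_set_law hnu (hF c) n (A n) (fun t => pvec t = v n)); congr (Pc c _).
apply/seteqP; split=> w.
  move=> H; split; last exact: H.
  by apply/AE => k kn; apply: H; exact: ltnW.
move=> [/AE H Hn] k; rewrite ltnS leq_eqVlt => /orP[/eqP->//|]; exact: H.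
Qed.

(* The roots of the trees of a forest with periodic root types provide a
   realization of the walks. *)
Lemma walks_exist : (0 < d)%N -> exists (c : nat -> 'I_d)
  (Y : O -> 'I_d -> nat -> {ffun 'I_d -> int}), indep_walks_law nu (Pc c) Y.
Proof.
(* Tree [m * d + i] has a root of type [i], and the offspring vector of that root serves as step [m]
   of walk [i]. *)
move=> d0; pose c k : 'I_d := Ordinal (ltn_pmod k d0).
pose Y w i n : {ffun 'I_d -> int} := \sum_(m < n) stepv i (pvec (F w (m * d + i)%N)).
exists c, Y; split; [|split].
- move=> i n z; pose f w := [seq pvec (F w (m * d + i)%N) | m <- iota 0 n].
  have df : discrete_rv f.
    by apply: discrete_rv_seq => k; apply: discrete_rv_comp; exact: (discrete_tree (hF c)).
  have := discrete_rv_set (fun s => \sum_(m < n) stepv i (nth [ffun=> 0%N] s m) = z) df.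
  rewrite (_ : [set w | _] = [set w | Y w i n = z]) //.
  rewrite predeqE => w /=; rewrite /Y /f.
  rewrite (eq_bigr (fun m : 'I_n => stepv i (pvec (F w (m * d + i)%N)))) // => m _.
  by rewrite (nth_map 0%N) ?size_iota // nth_iota.
- rewrite -(probability_setT (Pc c)); congr (Pc c _); apply/seteqP; split=> // w _ i.
  by rewrite /Y big_ord0.
apply: (@walk_law_of_steps _ _ _ _ _ _ _ (fun w i m => pvec (F w (m * d + i)%N))).
  by move=> w i m; rewrite /Y big_ord_recr /= addrAC subrr add0r.
move=> n v.
have dm (i : 'I_d) m : ((m * d + i) %% d = i)%N by rewrite modnMDl modn_small.
have dv (i : 'I_d) m : ((m * d + i) %/ d = m)%N by rewrite divnMDl // divn_small // addn0.
(* Euclidean division by [d] matches the first [n] steps of all walks with the first [n * d]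
   trees. *)
transitivity (Pc c [set w | forall k, (k < n * d)%N -> pvec (F w k) = v (c k) (k %/ d)%N]).
  congr (Pc c _); apply/seteqP; split=> w H.
    move=> k kn; have := H (c k) (k %/ d)%N; rewrite /= -divn_eq; apply.
    by rewrite ltn_divLR.
  move=> i m mn; rewrite H; last first.
    by apply: (@leq_trans (m.+1 * d)); rewrite ?leq_mul2r ?mn ?orbT // mulSn addnC ltn_add2r.
  by rewrite dv; congr v; apply: val_inj => /=; rewrite dm.
rewrite root_offspring_law; congr EFin.
rewrite -(big_mkord xpredT (fun k => nu (c k) (v (c k) (k %/ d)%N))) big_nat_mul big_mkord.
rewrite exchange_big /=; apply: eq_bigr => m _.
rewrite -{1}[(m * d)%N]add0n big_addn mulSn addnK big_mkord; apply: eq_bigr => i _.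
have -> : c (i + m * d)%N = i by apply: val_inj; rewrite /= addnC dm.
by rewrite addnC dv.
Qed.

Hypothesis hirr : irreducible_law nu.

(** Otherwise the trees with root of type [i] would have total mass 0. *)
Lemma tree_law_pos i : exists t, 0 < tree_law nu i t.
Proof.
apply: contrapT => H.
have := esum_forest_wt (hF (fun=> i)) 1; rewrite esum1 => [/eqP|[|t []] // _].
  by rewrite eq_sym onee_eq0.
rewrite /forest_wt big_ord_recl big_ord0 mulr1 /=; congr EFin.
apply/eqP; rewrite eq_le tree_law_ge0 // andbT leNgt; apply/negP => t0.
by apply: H; exists t.
Qed.

Lemma tree_law_pos_child (j k : 'I_d) (q : V) (B : pred T) (t : T) :
  0 < nu j q -> (0 < q k)%N -> 0 < tree_law nu k t -> has B (verts t) ->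
  exists2 t', 0 < tree_law nu j t' & has B (verts t').
Proof.
move=> nq qk wt Bt.
have [G GE] : exists G : 'I_d -> T, forall a, 0 < tree_law nu a (G a).
  by exists (fun a => projT1 (cid (tree_law_pos a))) => a; case: cid.
(* All children of type [k] are copies of [t], the others arbitrary trees of positive weight. *)
pose H a := if a == k then t else G a.
have HE a : 0 < tree_law nu a (H a) by rewrite /H; case: eqVneq => [->|].
have tH a : ttype (H a) = a.
  have := HE a; rewrite /tree_law; case: ifP; last by rewrite ltxx.
  by case/andP => /eqP.
have tHs : map (@ttype d) (map H (sorted_types q)) = sorted_types q.
  by rewrite -map_comp -[RHS]map_id; apply: eq_map.
have oq : offv (map H (sorted_types q)) = q := offv_types tHs.
exists (TNode j (map H (sorted_types q))).
  rewrite (@tree_law_node _ _ (nth j (sorted_types q))) oq ?size_map //.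
  rewrite mulr_gt0 //; apply: prodr_gt0 => -[a ha] _ /=.
  by move: ha; rewrite size_map => ha; rewrite (nth_map j).
have kq : k \in sorted_types q by rewrite -has_pred1 has_count count_sorted_types.
rewrite vertsE /=; apply/orP; right; case/hasP: Bt => x xt Bx; apply/hasP.
exists x => //; apply/flatten_mapP; exists (H k); first exact: map_f.
by rewrite /H eqxx.
Qed.

Lemma mean_matrix_neq0 j k : mean_matrix nu j k != 0 ->
  exists2 q, 0 < nu j q & (0 < q k)%N.
Proof.
rewrite mxE => M0; apply: contrapT => H; move: M0; apply/negP; rewrite negbK.
rewrite /mean_entry esum1 // => q _; congr EFin.
have [-> |q0] := posnP (q k); first by rewrite mulr0.
suff -> : nu j q = 0 by rewrite mul0r.
apply/eqP; rewrite eq_le (proj1 hnu) andbT leNgt; apply/negP => nq.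
by apply: H; exists q.
Qed.

(** A positive entry of a power of the mean matrix gives a chain of types, each a possible child of
    the one before; the tree is built along it from the end. *)
Lemma tree_with_type i j :
  exists2 t, 0 < tree_law nu j t & has (fun u => ttype u == i) (verts t).
Proof.
have [n] := hirr j i; move/gt_eqF/negbT.
elim: n j => [|n IH] j /=.
  move=> /mean_matrix_neq0[q nq qi]; have [t wt] := tree_law_pos i.
  apply: (tree_law_pos_child nq qi wt); rewrite vertsE /=.
  by move: wt; rewrite /tree_law; case: (_ == i) => //=; rewrite ltxx.
rewrite mxE => S0.
have [k Mk Nk] : exists2 k, mean_matrix nu j k != 0 &
    iter n (mulmx (mean_matrix nu)) (mean_matrix nu) k i != 0.
  apply: contrapT => H; move: S0; rewrite big1 ?eqxx // => k _.
  apply/eqP; rewrite mulf_eq0; apply/negPn/negP; rewrite negb_or => /andP[Mk Nk].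
  by apply: H; exists k.
have [q nq qk] := mean_matrix_neq0 Mk; have [t wt Bt] := IH k Nk.
exact: (tree_law_pos_child nq qk wt Bt).
Qed.

End OffspringLaw.

(** * From walks to forests and back *)

Section CodingWalk.
Variables (R : realType) (d : nat).
Local Notation T := (ttree d).
Local Notation V := {ffun 'I_d -> nat}.
Local Notation Q := {ffun 'I_d -> int}.
Variable nu : 'I_d -> V -> R.
Hypothesis hnu : is_progeny_law nu.
Hypothesis hirr : irreducible_law nu.
Context {dO0 : measure_display} {O0 : measurableType dO0}.
Variables (Pc : (nat -> 'I_d) -> probability O0 R) (F0 : O0 -> nat -> T).
Hypothesis hF0 : forall c, branching_forest nu (Pc c) F0 c.

Section Measurability.
Context {dO : measure_display} {O : measurableType dO}.
Variables (P : probability O R) (F : O -> nat -> T) (c : nat -> 'I_d).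
Hypothesis hF : branching_forest nu P F c.

Lemma as_infinite_types :
  almost_surely P (fun w => forall i N, exists2 k, (N <= k)%N & (0 < size (iroots i (F w k)))%N).
Proof.
apply: as_forall => i.
pose ex j := cid2 (tree_with_type hnu hF0 hirr i j).
apply: (@as_infinitely_often _ _ _ hnu _ _ _ _ _ hF (fun t => 0 < size (iroots i t))%N
          (fun j => s2val (ex j))) => j; case: (ex j) => t //= _.
exact: iroots_neq0.
Qed.

Lemma discrete_ustep i n : discrete_rv (fun w => ustep (F w) i n).
Proof.
move=> v.
pose A (K : nat) (s : seq T) := (n < size (ocode i s))%N /\ nth [ffun => 0%N] (ocode i s) n = v.
(* Either some finite prefix reaches index [n] and shows [v], or none does and [v] is the default
   zero vector. *)
rewrite (_ : [set w | _] = [set w | exists K, A K (trees (F w) K)] `|`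
   ([set w | forall K, (size (ocode i (trees (F w) K)) <= n)%N] `&` [set w | v = [ffun=> 0%N]])).
  apply: measurableU; first by apply: measurable_exists => K; exact: (measurable_trees hF K (A K)).
  apply: measurableI.
    by apply: measurable_forall => K; exact: (measurable_trees hF K (fun s => size (ocode i s) <= n)%N).
  have [->|nv] := pselect (v = [ffun=> 0%N]).
    by rewrite (_ : [set w | _] = setT) //; apply/seteqP; split.
  by rewrite (_ : [set w | _] = set0) //; apply/seteqP; split.
apply/seteqP; split=> w /=.
  move=> Ev; have [[K nK]|H] := pselect (exists K, (n < size (iprefix (F w) i K))%N).
    by left; exists K; rewrite /A -iprefixE -Ev (ustepE nK).
  right; split.
    by move=> K; rewrite -iprefixE leqNgt; apply/negP => nK; apply: H; exists K.
  by rewrite -Ev /ustep; case: pselect.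
case=> [[K [nK <-]]|[H ->]].
  by rewrite -iprefixE; apply: ustepE; rewrite iprefixE.
rewrite /ustep; case: pselect => // -[K nK]; exfalso.
by have := H K; rewrite -iprefixE leqNgt nK.
Qed.

Lemma discrete_Xv i n : discrete_rv (fun w => Xv (F w) i n).
Proof.
pose f w := [seq ustep (F w) i m | m <- iota 0 n].
have df : discrete_rv f by apply: discrete_rv_seq => m; exact: discrete_ustep.
move=> z.
have := discrete_rv_set (fun s => [ffun j => \sum_(m < n)
   ((nth [ffun=> 0%N] s m j)%:Z - (i == j)%:Z)] = z) df.
rewrite (_ : [set w | _] = [set w | Xv (F w) i n = z]) //.
rewrite predeqE => w /=; rewrite /Xv /Xw /f.
rewrite (_ : [ffun j => \sum_(m < n) _] = [ffun j => \sum_(m < n) ((ustep (F w) i m j)%:Z - (i == j)%:Z)]) //.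
apply/ffunP => j; rewrite !ffunE; apply: eq_bigr => m _.
by rewrite (nth_map 0%N) ?size_iota // nth_iota.
Qed.

Lemma measurable_ustep_eq n (v : 'I_d -> nat -> V) :
  measurable [set w | forall i m, (m < n)%N -> ustep (F w) i m = v i m].
Proof.
apply: measurable_forall => i; apply: measurable_forall => m.
exact: (discrete_rv_set (fun q => (m < n)%N -> q = v i m) (@discrete_ustep i m)).
Qed.

Definition read_code n (v : 'I_d -> nat -> V) (s : seq T) : Prop :=
  forall i m, (m < n)%N -> (m < size (ocode i s))%N /\ nth [ffun=> 0%N] (ocode i s) m = v i m.

(** The sequence involves only [nu] and [c], so forests with the same root types have coding walks
    of the same law, even on different spaces. The events increase with [K], and almost surely all
    codes become long. *)
Lemma ustep_law_cvg n (v : 'I_d -> nat -> V) :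
  (fun K => \esum_(s in [set s | size s = K /\ read_code n v s]) (forest_wt nu c s)%:E)
    @ \oo --> P [set w | forall i m, (m < n)%N -> ustep (F w) i m = v i m].
Proof.
pose B K := [set w | read_code n v (trees (F w) K)].
have mB K : measurable (B K) := measurable_trees hF K (read_code n v).
have -> : (fun K => \esum_(s in [set s | size s = K /\ read_code n v s]) (forest_wt nu c s)%:E) =
    P \o B.
  by apply/funext => K; rewrite /comp /B (trees_set_law hF).
have mono K K' w i : (K <= K')%N ->
    exists l, ocode i (trees (F w) K') = ocode i (trees (F w) K) ++ l.
  by move=> KK'; have := iprefix_mono (F w) i KK'; rewrite !iprefixE.
have ndB : nondecreasing_seq B.
  move=> K K' KK'; rewrite subsetEset => w BK i m mn.
  have [l E] := mono _ _ w i KK'; have [mK <-] := BK i m mn.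
  by rewrite E size_cat nth_cat mK; split=> //; exact: ltn_addr.
have mU : measurable (\bigcup_K B K) by exact: bigcupT_measurable.
rewrite (_ : P [set w | _] = P (\bigcup_K B K)); first exact: nondecreasing_cvg_mu.
have -> : \bigcup_K B K = [set w | exists K, B K w].
  by apply/seteqP; split=> [w [K _]|w [K]]; exists K.
apply: as_eq; first exact: measurable_ustep_eq.
  exact: measurable_exists.
apply: as_S as_infinite_types => w inf; split=> [H|[K BK] i m mn]; last first.
  have [mK <-] := BK i m mn.
  by rewrite -iprefixE in mK *; exact: ustepE.
have [K HK] : exists K, forall i, (n <= size (ocode i (trees (F w) K)))%N.
  have HK0 i : exists K, (n <= size (ocode i (trees (F w) K)))%N.
    by have [K nK] := iprefix_unbounded (inf i) n; exists K; rewrite -iprefixE ltnW.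
  pose f i := projT1 (cid (HK0 i)).
  exists (\max_i f i) => i; have [l ->] := mono _ _ w i (leq_bigmax (F := f) i).
  by rewrite size_cat (leq_trans _ (leq_addr _ _)) // /f; case: cid.
exists K => i m mn; have mK := leq_trans mn (HK i); split=> //.
by rewrite -H // -iprefixE; apply/esym/ustepE; rewrite iprefixE.
Qed.

End Measurability.

Section Decoding.
Context {dO : measure_display} {O : measurableType dO}.
Variables (P : probability O R) (Y : O -> 'I_d -> nat -> Q) (c : nat -> 'I_d).
Hypothesis hY : indep_walks_law nu P Y.

Definition decodes K (s : seq T) (w : O) : Prop :=
  [/\ size s = K, valid c s & starts_with Y (fun i => map (stepv i) (ocode i s)) w].

Lemma decodes_nth K s w i m : decodes K s w -> (m < size (ocode i s))%N ->
  Y w i m.+1 - Y w i m = stepv i (nth [ffun=> 0%N] (ocode i s) m).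
Proof.
by case=> _ _ H ms; rewrite H ?size_map // (nth_map [ffun=> 0%N]).
Qed.

(** Codes read from the same steps are compatible, so the prefix code property applies. *)
Lemma decodes_inj K s s' w : decodes K s w -> decodes K s' w -> s = s'.
Proof.
move=> D D'; have [ss vs _] := D; have [ss' vs' _] := D'.
apply: (code_valid_inj vs vs'); first by rewrite ss.
move=> i; apply: (@nth_compatible _ [ffun=> 0%N]) => m ms ms'.
by apply: (@stepv_inj _ i); rewrite -(decodes_nth D ms) -(decodes_nth D' ms').
Qed.

Lemma decodes_take K k s w : decodes K s w -> (k <= K)%N -> decodes k (take k s) w.
Proof.
move=> D kK; have [ss vs _] := D; split.
- by rewrite size_take_min ss; exact/minn_idPl.
- exact: valid_take.
move=> i m; rewrite size_map => mk.
have E : ocode i s = ocode i (take k s) ++ ocode i (drop k s) by rewrite -ocode_cat cat_take_drop.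
have := @decodes_nth _ _ _ i m D; rewrite E size_cat nth_cat mk.
by rewrite (nth_map [ffun=> 0%N]) //; apply; exact: ltn_addr.
Qed.

Lemma measurable_decodes K s : measurable [set w | decodes K s w].
Proof.
have [/andP[/eqP ss vs]|H] := boolP ((size s == K) && valid c s).
  rewrite (_ : [set w | _] = [set w | starts_with Y (fun i => map (stepv i) (ocode i s)) w]).
    exact: (measurable_starts_with hY).
  by apply/seteqP; split=> w; [case|split].
rewrite (_ : [set w | _] = set0) //; apply/seteqP; split=> w // -[ss vs _].
by move: H; rewrite ss eqxx vs.
Qed.

Lemma decodes_law K s : size s = K -> valid c s ->
  P [set w | decodes K s w] = (forest_wt nu c s)%:E.
Proof.
move=> ss vs; rewrite (forest_wt_code nu vs).
rewrite (_ : [set w | _] = [set w | starts_with Y (fun i => map (stepv i) (ocode i s)) w]).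
  rewrite (starts_with_law hnu hY); congr EFin; apply: eq_bigr => i _.
  by rewrite big_map; apply: eq_bigr => v _; rewrite step_law_stepv.
by apply/seteqP; split=> w; [case|split].
Qed.

(* The codes of the valid forests of [K] trees are pairwise incompatible and
   carry total mass 1 for the law of the walk. *)
Lemma as_decodes : almost_surely P (fun w => forall K, exists s, decodes K s w).
Proof.
apply: as_forall => K; apply/as_prob1.
  by apply: measurable_exists => s; exact: measurable_decodes.
rewrite measure_disjoint_exists; last 2 first.
- exact: measurable_decodes.
- by move=> s s' w; exact: decodes_inj.
rewrite -(esum_forest_wt_valid (hF0 c) K) [RHS]esum_mkcond; apply: eq_esum => s _.
case: ifPn => [/set_mem[ss vs]|/negP ns]; first exact: decodes_law.
by rewrite measure_empty // => w [ss vs _]; apply: ns; rewrite inE.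
Qed.

Let t0 := TNode (c 0%N) [::] : T.

(** Tree [k] is read from the decoding of [k + 1] trees; longer decodings restrict to it. Where
    decoding fails, which is negligible, the tree is [t0]. *)
Definition decoded_forest (w : O) (k : nat) : T :=
  if pselect (exists s, decodes k.+1 s w) is left h then nth t0 (projT1 (cid h)) k else t0.

Lemma decoded_forestE K s w k : decodes K s w -> (k < K)%N ->
  decoded_forest w k = nth t0 s k.
Proof.
move=> D kK; have D' := decodes_take D kK.
rewrite /decoded_forest; case: pselect => [h|[]]; last by exists (take k.+1 s).
by case: cid => s' /= /(decodes_inj D') <-; rewrite nth_take.
Qed.

Lemma trees_decoded K s w : decodes K s w -> trees (decoded_forest w) K = s.
Proof.
move=> D; have [ss _ _] := D.
apply: (@eq_from_nth _ t0); rewrite size_trees ?ss // => k kK.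
by rewrite nth_trees // (decoded_forestE D).
Qed.

Lemma measurable_decoded k t : measurable [set w | decoded_forest w k = t].
Proof.
rewrite (_ : [set w | _] = [set w | exists s, nth t0 s k = t /\ decodes k.+1 s w] `|`
   ([set w | t0 = t] `&` ~` [set w | exists s, decodes k.+1 s w])).
  have mc (X : Prop) : measurable [set w : O | X].
    have [x|x] := pselect X.
      by rewrite (_ : [set w | _] = setT) //; apply/seteqP; split.
    by rewrite (_ : [set w | _] = set0) //; apply/seteqP; split.
  apply: measurableU.
    apply: measurable_exists => s; apply: (measurableI _ _ (mc (nth t0 s k = t))).
    exact: measurable_decodes.
  apply: measurableI; first exact: mc.
  by apply: measurableC; apply: measurable_exists => s; exact: measurable_decodes.
apply/seteqP; split=> w /=.
  move=> <-; have [[s D]|H] := pselect (exists s, decodes k.+1 s w).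
    by left; exists s; rewrite (decoded_forestE D).
  by right; split=> //; rewrite /decoded_forest; case: pselect.
case=> [[s [<- D]]|[<- H]]; first by rewrite (decoded_forestE D).
by rewrite /decoded_forest; case: pselect.
Qed.

(** Where decoding succeeds, the first [n] trees are [s] exactly when [s] decodes the walk, an event
    whose probability is the weight of [s]. *)
Lemma decoded_branching : branching_forest nu P decoded_forest c.
Proof.
split; first exact: measurable_decoded.
move=> n ts; pose s := [seq ts k | k <- iota 0 n].
have sn : size s = n by rewrite size_map size_iota.
have -> : \prod_(k < n) tree_law nu (c k) (ts k) = forest_wt nu c s.
  by rewrite /forest_wt sn; apply: eq_bigr => k _; rewrite (nth_trees _ ts).
have mE : measurable [set w | forall k, (k < n)%N -> decoded_forest w k = ts k].
  apply: measurable_forall => k.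
  apply: (discrete_rv_set (fun t => (k < n)%N -> t = ts k)) => t.
  exact: measurable_decoded.
have E s' w : decodes n s' w ->
    (forall k, (k < n)%N -> decoded_forest w k = ts k) <-> s' = s.
  move=> D; have [ss' _ _] := D; split=> [H|ss k kn].
    apply: (@eq_from_nth _ t0); rewrite ss' ?sn // => k kn.
    by rewrite -(decoded_forestE D kn) H // (nth_trees _ ts).
  by rewrite (decoded_forestE D kn) ss (nth_trees _ ts).
have [vs|nvs] := boolP (valid c s).
  rewrite -(decodes_law sn vs); apply: as_eq => //; first exact: measurable_decodes.
  apply: as_S as_decodes => w /(_ n)[s' D]; rewrite (E _ _ D).
  by split=> [<- //|]; exact: decodes_inj.
(* A list that is not valid has weight 0 and never decodes the walk. *)
transitivity (P [set w : O | False]); last first.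
  by rewrite forest_wtE (negbTE nvs) measure_empty // => w [].
apply: as_eq => //; first exact: measurable0.
apply: as_S as_decodes => w /(_ n)[s' D]; rewrite (E _ _ D).
by split=> // ss; have [_] := D; rewrite ss (negbTE nvs).
Qed.

Lemma measurable_Xv_eq (F : O -> nat -> T) : branching_forest nu P F c ->
  measurable [set w | forall i n, Xv (F w) i n = Y w i n].
Proof.
move=> hF; apply: measurable_forall => i; apply: measurable_forall => n.
rewrite (_ : [set w | _] = [set w | exists z, Xv (F w) i n = z /\ Y w i n = z]).
  apply: measurable_exists => z.
  exact: (measurableI _ _ (discrete_Xv hF i n z) (proj1 hY i n z)).
by apply/seteqP; split=> [w /= ->|w /= [z [-> ->]]] //; exists (Y w i n).
Qed.

(** The decoded forest almost surely has infinitely many vertices of each type, so each step of the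
    walk lies in the code of a decoded finite piece. *)
Lemma as_Xv_decoded : almost_surely P (fun w => forall i n, Xv (decoded_forest w) i n = Y w i n).
Proof.
have Y0 : almost_surely P (fun w => forall i, Y w i 0%N = 0).
  apply/as_prob1; last exact: (proj1 (proj2 hY)).
  by apply: measurable_forall => i; exact: (proj1 hY).
apply: as_S (as_I (as_I as_decodes (as_infinite_types decoded_branching)) Y0).
move=> w [[D inf] Yw0] i; elim=> [|n IH]; first by rewrite Xv0 Yw0.
have [K nK] := iprefix_unbounded (inf i) n; have [s Ds] := D K.
have := XvS (decoded_forest w) i n; rewrite IH (ustepE nK).
rewrite iprefixE (trees_decoded Ds) in nK *; rewrite -(decodes_nth Ds nK).
exact: addIr.
Qed.

(** The first trees of such a forest decode the walk, and decoding is unique. *)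
Lemma as_decoded_unique (F : O -> nat -> T) : branching_forest nu P F c ->
  almost_surely P (fun w => forall i n, Xv (F w) i n = Y w i n) ->
  almost_surely P (fun w => F w = decoded_forest w).
Proof.
move=> hF XY; apply: as_S (as_I (as_valid hF) XY) => w [vF XF].
apply/funext => k; have D : decodes k.+1 (trees (F w) k.+1) w.
  split; [exact: size_trees|exact: vF|] => i m; rewrite size_map => ms.
  rewrite -!XF XvS (nth_map [ffun=> 0%N]) //; congr stepv.
  by rewrite -iprefixE in ms *; exact: ustepE.
by rewrite (decoded_forestE D) // nth_trees.
Qed.

End Decoding.

(** Compare with the forest of root types [c] decoded from a realization [Y] of the walks under
    [Pc c']: both coding walks have the same law, and the second one is almost surely [Y]. *)
Lemma forest_ustep_law (hd : (0 < d)%N) {dO : measure_display} {O : measurableType dO}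
    (P : probability O R) (F : O -> nat -> T) (c : nat -> 'I_d) :
  branching_forest nu P F c ->
  forall n (v : 'I_d -> nat -> V),
    P [set w | forall i m, (m < n)%N -> ustep (F w) i m = v i m] =
    (\prod_(i < d) \prod_(m < n) nu i (v i m))%:E.
Proof.
move=> hF n v; have [c' [Y hY]] := walks_exist hnu hF0 hd.
have hD := decoded_branching c hY; have XD := as_Xv_decoded c hY.
transitivity (Pc c' [set w | forall i m, (m < n)%N -> ustep (decoded_forest Y c w) i m = v i m]).
  exact: cvg_unique (@ustep_law_cvg _ _ _ _ _ hF n v) (@ustep_law_cvg _ _ _ _ _ hD n v).
under [in RHS]eq_bigr do under eq_bigr do rewrite -step_law_stepv.
rewrite -(proj2 (proj2 hY) n (fun i m => stepv i (v i m))).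
apply: as_eq; first exact: (measurable_ustep_eq hD).
  apply: measurable_forall => i; apply: measurable_forall => m.
  exact: (discrete_rv_set (fun q => (m < n)%N -> q = stepv i (v i m)) (discrete_step hY i m)).
apply: as_S XD => w XY.
by split=> H i m mn; [rewrite -!XY XvS H|apply: (@stepv_inj _ i); rewrite -XvS !XY H].
Qed.

End CodingWalk.

(** * Coding of branching forests by independent walks *)

Theorem theorem3p1 (R : realType) (d : nat) (hd : (2 <= d)%N)
  (nu : 'I_d -> {ffun 'I_d -> nat} -> R)
  (hnu : is_progeny_law nu) (hirr : irreducible_law nu)
  (hnd : nondegenerated_law nu) (hcrit : crit_or_subcrit nu)
  (dO : measure_display) (O : measurableType dO)
  (Pc : (nat -> 'I_d) -> probability O R) (F : O -> nat -> ttree d)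
  (hF : forall c : nat -> 'I_d, branching_forest nu (Pc c) F c) :
  (* 1. *)
  (forall c : nat -> 'I_d,
     indep_walks_law nu (Pc c) (fun w => Xv (F w)) /\
     (forall i : 'I_d,
        (forall w n, -1 <= Xw (F w) i i n.+1 - Xw (F w) i i n) /\
        Pc c [set w | forall (M : int) (N : nat),
                exists n, (N <= n)%N /\ Xw (F w) i i n <= M] = 1%E /\
        (forall j : 'I_d, j != i ->
           forall w n, Xw (F w) i j n <= Xw (F w) i j n.+1))) /\
  (* 2. *)
  (forall (c : nat -> 'I_d) (r : nat), (1 <= r)%N ->
     Pc c [set w | exists rv : 'I_d -> nat, (\sum_(i < d) rv i)%N = r /\
                     exists n, is_smallest_solution rv (Xw (F w)) n] = 1%E) /\
  (* 3. *)
  (forall (dO' : measure_display) (O' : measurableType dO')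
          (P' : probability O' R) (Y : O' -> 'I_d -> nat -> {ffun 'I_d -> int})
          (c : nat -> 'I_d),
     indep_walks_law nu P' Y ->
     exists F' : O' -> nat -> ttree d,
       branching_forest nu P' F' c /\
       P' [set w | forall i n, Xv (F' w) i n = Y w i n] = 1%E /\
       (forall F'' : O' -> nat -> ttree d,
          branching_forest nu P' F'' c ->
          P' [set w | forall i n, Xv (F'' w) i n = Y w i n] = 1%E ->
          P' [set w | F'' w = F' w] = 1%E)).
Proof.
have d0 : (0 < d)%N := ltnW hd.
split; [|split].
- move=> c; split.
    split; first by move=> i n z; exact: (discrete_Xv (hF c)).
    split.
      rewrite -(probability_setT (Pc c)); congr (Pc c _).
      by apply/seteqP; split=> // w _ i; exact: Xv0.
    apply: (@walk_law_of_steps _ _ _ _ _ _ _ (fun w i m => ustep (F w) i m)).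
      by move=> w i m; exact: XvS.
    exact: (forest_ustep_law hnu hirr hF d0 (hF c)).
  move=> i; split; [|split].
  + by move=> w n; exact: Xw_skip.
  + apply/as_prob1.
      apply: measurable_forall => M; apply: measurable_forall => N.
      apply: measurable_exists => n.
      have := discrete_rv_set (fun q : {ffun 'I_d -> int} => (N <= n)%N /\ q i <= M)
        (discrete_Xv (hF c) i n).
      by under eq_set do rewrite ffunE.
    apply: as_S (as_infinite_types hnu hirr hF (hF c)) => w inf.
    exact: Xw_diag_liminf.
  + by move=> j ji w n; exact: Xw_mono.
- move=> c r _; rewrite -(probability_setT (Pc c)); congr (Pc c _).
  apply/seteqP; split=> // w _.
  (* The root types of the first [r] trees work in every realization, so the event is the whole
     space. *)
  exists (fun j => count (fun t => ttype t == j) (trees (F w) r)); split.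
    rewrite -[RHS](size_trees (F w) r).
    elim: (trees (F w) r) => [|t s IH] /=; first by rewrite big1.
    rewrite big_split IH /= (bigD1 (ttype t)) //= eqxx big1 // => j.
    by rewrite eq_sym => /negbTE ->.
  apply: (smallest_solution_exists _ _ _ (forest_solution (F w) r)).
  + by move=> i j; rewrite /Xw big_ord0.
  + by move=> i n; exact: Xw_skip.
  + by move=> i j n; exact: Xw_mono.
move=> dO' O' P' Y c hY; exists (decoded_forest Y c).
have hD := decoded_branching hnu hF c hY.
split=> //; split.
  apply/as_prob1; first exact: (measurable_Xv_eq hY hD).
  exact: (as_Xv_decoded hnu hirr hF).
move=> F'' hF'' XF''.
have mX := measurable_Xv_eq hY hF''.
apply/as_prob1; last exact: (as_decoded_unique hF'' (proj2 (as_prob1 P' mX) XF'')).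
(* Equality tree by tree is a countable intersection of measurable events. *)
rewrite (_ : [set w | _] = [set w | forall k, F'' w k = decoded_forest Y c w k]).
  apply: measurable_forall => k.
  rewrite (_ : [set w | _] = [set w | exists t, F'' w k = t /\ decoded_forest Y c w k = t]).
    by apply: measurable_exists => t; exact: (measurableI _ _ (proj1 hF'' k t) (proj1 hD k t)).
  by apply/seteqP; split=> [w /= ->|w /= [t [-> ->]]] //; exists (decoded_forest Y c w k).
by apply/seteqP; split=> [w /= E|w /= E]; [move=> k; rewrite E | apply/funext].
Qed.
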